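(* Let $T$ be a complete first-order theory. The mapping $\bar f\colon u\mathcal{M}/H(u\mathcal{M})\to \mathrm{Gal}_L(T)$ defined in the context is a topological group quotient mapping (i.e. it is a surjective homomorphism such that any given subset of $\mathrm{Gal}_L(T)$ is closed if and only if its preimage under $\bar f$ is closed). Thus, the induced group isomorphism from $(u\mathcal{M}/H(u\mathcal{M}))/\ker(\bar f)$ to $\mathrm{Gal}_L(T)$ is a homeomorphism.
   Context: ''Compact'' does not include Hausdorff. A monster model is a model that is $\kappa$-saturated and strongly $\kappa$-homogeneous for a sufficiently large strong limit cardinal $\kappa$ (its degree of saturation); ''small'' means of cardinality less than the degree of saturation. $\mathfrak{C}$ is a monster model of $T$, $\bar c$ is a tuple enumerating all elements of $\mathfrak{C}$, and $\mathfrak{C}'\succ\mathfrak{C}$ is a bigger monster model whose degree of saturation is much bigger than $|\mathfrak{C}|$. Put $S_{\bar c}(\mathfrak{C})=\{\mathrm{tp}(\bar a/\mathfrak{C}) : \bar a\equiv\bar c\}$ ($\bar a$ from $\mathfrak{C}'$), a compact Hausdorff space on which $\mathrm{Aut}(\mathfrak{C})$ acts naturally. $EL$ is the Ellis semigroup of this action: the closure of $\mathrm{Aut}(\mathfrak{C})$ (each automorphism viewed as a map $S_{\bar c}(\mathfrak{C})\to S_{\bar c}(\mathfrak{C})$) in the product space $S_{\bar c}(\mathfrak{C})^{S_{\bar c}(\mathfrak{C})}$, with composition as semigroup operation; $\mathrm{Aut}(\mathfrak{C})$ is regarded as a subset of $EL$. $\mathcal{M}$ is any minimal left ideal of $EL$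 and $u\in\mathcal{M}$ any idempotent; then $u\mathcal{M}$ is a group with identity $u$ (the Ellis group). For $A\subseteq EL$ and $p\in EL$, $p\circ A$ is the set of all $\eta\in EL$ for which there are nets $(\eta_i)$ in $A$ and $(g_i)$ in $\mathrm{Aut}(\mathfrak{C})$ with $\lim g_i=p$ and $\lim g_i\eta_i=\eta$. For $A\subseteq u\mathcal{M}$, $\mathrm{cl}_\tau(A)=(u\circ A)\cap u\mathcal{M}$; this is a closure operator which defines the $\tau$-topology on $u\mathcal{M}$ (it is compact, $T_1$, and multiplication is separately continuous). $H(u\mathcal{M})$ is the intersection of the sets $\mathrm{cl}_\tau(V)$ over all $\tau$-neighborhoods $V$ of $u$; it is a $\tau$-closed normal subgroup of $u\mathcal{M}$, and $u\mathcal{M}/H(u\mathcal{M})$ with the quotient topology (also called the $\tau$-topology) is a compact Hausdorff group. Galois group (computed in $\mathfrak{C}'$): $\mathrm{Autf}_L(\mathfrak{C}')$ is the (normal) subgroup of $\mathrm{Aut}(\mathfrak{C}')$ generated by all automorphisms fixing pointwise some small submodel; $\mathrm{Gal}_L(T)=\mathrm{Aut}(\mathfrak{C}')/\mathrm{Autf}_L(\mathfrak{C}')$. Its topology: for a small model $M$ enumerated by $\bar m$, $\mathrm{Gal}_L(T)$ carries the quotient topology from the map $S_{\bar m}(M)\to\mathrm{Gal}_L(T)$, $\mathrm{tp}(\sigma(\bar m)/M)\mapsto\sigma\,\mathrm{Autf}_L(\mathfrak{C}')$ (well defined and independent of $M$); it is a compact, not necessarily Hausdorff, topological group. For $x\in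 EL$ let $\pi_0(x)=x(\mathrm{tp}(\bar c/\mathfrak{C}))\in S_{\bar c}(\mathfrak{C})$. The map $\hat f\colon EL\to\mathrm{Gal}_L(T)$ is $\hat f(x)=\sigma'\,\mathrm{Autf}_L(\mathfrak{C}')$, where $\sigma'\in\mathrm{Aut}(\mathfrak{C}')$ is any automorphism with $\sigma'(\bar c)\models\pi_0(x)$ (well defined, a semigroup epimorphism). $f=\hat f|_{u\mathcal{M}}$ is a group epimorphism which is trivial on $H(u\mathcal{M})$, and $\bar f\colon u\mathcal{M}/H(u\mathcal{M})\to\mathrm{Gal}_L(T)$, $\bar f(pH(u\mathcal{M}))=f(p)$, is the induced epimorphism. *)

(* Defs.v *)
From HB Require Import structures.
From mathcomp Require Import all_boot.
From mathcomp Require Import all_classical topology.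

Set Implicit Arguments.
Unset Strict Implicit.
Unset Printing Implicit Defensive.

Local Open Scope classical_set_scope.
Local Open Scope quotient_scope.
Local Open Scope group_scope.
Local Open Scope card_scope.

Local Obligation Tactic := idtac.

(** * First-order logic *)

Record language := Language {
  fsym : Type;
  far : fsym -> nat;
  rsym : Type;
  rar : rsym -> nat }.

(* Terms and formulas have their free variables in an arbitrary type [V].
   Formulas with variables [x_i] ([i : I]) and parameters from a set [A] are
   [formula L (I + A)]; under [fall] the bound variable is [None]. *)
Inductive term (L : language) (V : Type) : Type :=
| tvar of V
| tapp (f : fsym L) of ('I_(far f) -> term L V).

Inductive formula (L : language) (V : Type) : Type :=
| fbot
| feq of term L V & term L V
| frel (r : rsym L) of ('I_(rar r) -> term L V)
| fimp of formula L V & formula L V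
| fall of formula L (option V).

Arguments fbot {L V}.

HB.instance Definition _ L V := gen_eqMixin (formula L V).
HB.instance Definition _ L V := gen_choiceMixin (formula L V).
HB.instance Definition _ L V := isPointed.Build (formula L V) fbot.

Record structure (L : language) := Structure {
  dom :> Type;
  dom_inh : inhabited dom;
  ifun : forall f : fsym L, ('I_(far f) -> dom) -> dom;
  irel : forall r : rsym L, ('I_(rar r) -> dom) -> Prop }.

Definition scons (V X : Type) (x : X) (v : V -> X) (o : option V) : X :=
  if o is Some y then v y else x.

Definition scase (I A X : Type) (a : I -> X) (b : A -> X) (s : I + A) : X :=
  match s with inl i => a i | inr y => b y end.

Fixpoint teval L (M : structure L) V (v : V -> M) (t : term L V) : M :=
  match t with
  | tvar x => v x
  | tapp f ts => ifun (fun i => teval v (ts i))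
  end.

Fixpoint sat L (M : structure L) V (v : V -> M) (phi : formula L V) : Prop :=
  match phi with
  | fbot => False
  | feq s t => teval v s = teval v t
  | frel r ts => irel (fun i => teval v (ts i))
  | fimp phi psi => sat v phi -> sat v psi
  | fall phi => forall x : M, sat (scons x v) phi
  end.

Fixpoint tren L V W (r : V -> W) (t : term L V) : term L W :=
  match t with
  | tvar x => tvar L (r x)
  | tapp f ts => tapp (fun i => tren r (ts i))
  end.

Fixpoint fren L V W (r : V -> W) (phi : formula L V) : formula L W :=
  match phi with
  | fbot => fbot
  | feq s t => feq (tren r s) (tren r t)
  | frel R ts => frel (fun i => tren r (ts i))
  | fimp phi psi => fimp (fren r phi) (fren r psi)
  | fall phi => fall (fren (omap r) phi)
  end.

Definition fneg L V (phi : formula L V) := fimp phi fbot.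

Definition theory L := set (formula L void).

Definition models L (M : structure L) (T : theory L) :=
  forall phi, T phi -> sat (of_void M) phi.

Definition entails L (T : theory L) (phi : formula L void) :=
  forall M : structure L, models M T -> sat (of_void M) phi.

Definition complete_theory L (T : theory L) :=
  (exists M : structure L, models M T) /\
  forall phi, entails T phi \/ entails T (fneg phi).

(* Equality of the types (over the empty set) of two tuples. *)
Definition same_type L (M N : structure L) I (a : I -> M) (b : I -> N) :=
  forall phi : formula L I, sat a phi <-> sat b phi.

Definition elementary L (M N : structure L) (h : M -> N) :=
  forall (V : Type) (v : V -> M), same_type v (h \o v).

(** * Automorphism groups *)

Record aut L (M : structure L) := Aut {
  aut_fun :> M -> M;
  aut_inv : M -> M;
  aut_funK : cancel aut_fun aut_inv;
  aut_invK : cancel aut_inv aut_fun;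
  aut_ifun : forall (f : fsym L) x, aut_fun (@ifun L M f x) = ifun (aut_fun \o x);
  aut_irel : forall (r : rsym L) x, @irel L M r x <-> irel (aut_fun \o x) }.

HB.instance Definition _ L M := gen_eqMixin (@aut L M).
HB.instance Definition _ L M := gen_choiceMixin (@aut L M).

Lemma aut_ext L (M : structure L) (s t : aut M) : s =1 t -> s = t.
Proof.
case: s t => [f fi fK fiK f1 f2] [g gi gK giK g1 g2] /= /funext fg.
subst g; have figi : fi = gi.
  by apply/funext => x; rewrite -{1}(giK x) fK.
by subst gi; congr Aut; apply: Prop_irrelevance.
Qed.

Section AutGroup.
Variables (L : language) (M : structure L).

Program Definition aut_one : aut M := @Aut L M id id _ _ _ _.
Next Obligation. by []. Qed.
Next Obligation. by []. Qed.
Next Obligation. by []. Qed.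
Next Obligation. by []. Qed.

Program Definition aut_invg (s : aut M) : aut M :=
  @Aut L M (aut_inv s) s _ _ _ _.
Next Obligation. move=> s; exact: aut_invK. Qed.
Next Obligation. move=> s; exact: aut_funK. Qed.
Next Obligation.
move=> s f x; apply: (can_inj (@aut_funK _ _ s)); rewrite aut_invK aut_ifun.
by congr ifun; apply/funext => i /=; rewrite aut_invK.
Qed.
Next Obligation.
move=> s r x; rewrite (aut_irel s (_ \o x)).
suff -> : s \o (aut_inv s \o x) = x by [].
by apply/funext => i /=; rewrite aut_invK.
Qed.

(* The product is composition: [(s * t) x = s (t x)]. *)
Program Definition aut_mul (s t : aut M) : aut M :=
  @Aut L M (s \o t) (aut_inv t \o aut_inv s) _ _ _ _.
Next Obligation. by move=> s t x /=; rewrite !aut_funK. Qed.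
Next Obligation. by move=> s t x /=; rewrite !aut_invK. Qed.
Next Obligation. by move=> s t f x /=; rewrite !aut_ifun. Qed.
Next Obligation. by move=> s t r x; rewrite (aut_irel t) (aut_irel s). Qed.

Lemma aut_mulA : associative aut_mul.
Proof. by move=> s t r; apply: aut_ext. Qed.
Lemma aut_mul1 : left_id aut_one aut_mul.
Proof. by move=> s; apply: aut_ext. Qed.
Lemma aut_1mul : right_id aut_one aut_mul.
Proof. by move=> s; apply: aut_ext. Qed.
Lemma aut_mulV : left_inverse aut_one aut_invg aut_mul.
Proof. by move=> s; apply: aut_ext => x /=; rewrite aut_funK. Qed.
Lemma aut_Vmul : right_inverse aut_one aut_invg aut_mul.
Proof. by move=> s; apply: aut_ext => x /=; rewrite aut_invK. Qed.

HB.instance Definition _ := isGroup.Build (aut M)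
  aut_mulA aut_mul1 aut_1mul aut_mulV aut_Vmul.

End AutGroup.

Lemma teval_ren L (M : structure L) V W (r : V -> W) (v : W -> M) t :
  teval v (tren r t) = teval (v \o r) t.
Proof.
by elim: t => //= f ts IH; congr ifun; apply/funext => i; apply: IH.
Qed.

Lemma sat_ren L (M : structure L) V W (r : V -> W) (v : W -> M) phi :
  sat v (fren r phi) <-> sat (v \o r) phi.
Proof.
elim: phi W r v => {V} [V|V s t|V R ts|V phi IH1 psi IH2|V phi IH] W r v //=.
- by rewrite !teval_ren.
- by under eq_fun do rewrite teval_ren.
- by rewrite IH1 IH2.
- suff E x : scons x v \o omap r = scons x (v \o r).
    by split=> H x; have := H x; rewrite IH E.
  by apply/funext => -[].
Qed.

Lemma aut_elementary L (M : structure L) (s : aut M) : elementary s.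
Proof.
have tE V (v : V -> M) t : teval (s \o v) t = s (teval v t).
  by elim: t => //= f ts IH; rewrite aut_ifun; congr ifun; apply/funext => i; apply: IH.
move=> V v phi.
elim: phi v => {V} [V|V t1 t2|V R ts|V phi IH1 psi IH2|V phi IH] v //=.
- by rewrite !tE; split=> [->//|/(can_inj (@aut_funK _ _ s))].
- by under [X in _ <-> irel X]eq_fun do rewrite tE; exact: aut_irel.
- by rewrite IH1 IH2.
- have E x : s \o scons x v = scons (s x) (s \o v) by apply/funext => -[].
  split=> H x; last by rewrite IH E.
  by have := H (aut_inv s x); rewrite IH E aut_invK.
Qed.

(** * Monster models *)

(* A cardinal is given by a type of that cardinality. *)
Definition card_lt (X Y : Type) : bool :=
  ([set: X] #<= [set: Y]) && ~~ ([set: Y] #<= [set: X]).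

Lemma inj_card_le_type (X Y : Type) (f : X -> Y) :
  injective f -> [set: X] #<= [set: Y].
Proof.
move=> fI; have /injPex[g] : exists f : X -> Y, set_inj [set: X] f.
  by exists f => x y _ _; exact: fI.
have := card_image g; rewrite card_eq_sym => /card_eqPle[Xg _].
exact: card_le_trans Xg (card_leT _).
Qed.

Lemma card_lt_le (X Y K : Type) :
  [set: X] #<= [set: Y] -> card_lt Y K -> card_lt X K.
Proof.
move=> XY /andP[YK KY]; rewrite /card_lt (card_le_trans XY YK) /=.
by apply: contra KY => KX; exact: card_le_trans XY.
Qed.

Lemma card_lt_surj (X Y K : Type) (f : X -> Y) :
  (forall y, exists x, f x = y) -> card_lt X K -> card_lt Y K.
Proof.
move=> fS; apply: card_lt_le; have [g gK] := choice fS.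
exact: inj_card_le_type (can_inj gK).
Qed.

Definition strong_limit (kappa : Type) :=
  forall X : Type, card_lt X kappa -> card_lt (set X) kappa.

Lemma card_lt_sum (K X : Type) :
  strong_limit K -> card_lt X K -> card_lt (X + X)%type K.
Proof.
move=> sl /sl /sl; apply: card_lt_le.
pose f (z : X + X) : set (set X) :=
  scase (fun x => [set [set x]]) (fun x => [set [set x]; set0]) z.
have f0 x y : ([set [set x]; set0] : set (set X)) `<=` [set [set y]] -> False.
  by move=> /(_ set0 (or_intror erefl)) /= e; have : [set y] y by []; rewrite -e.
have fx (x y : X) : [set x] = [set y] -> x = y.
  by move=> e; have : [set x] x by []; rewrite e.
apply: (@inj_card_le_type _ _ f) => -[] x [] y /= e.
- congr inl; apply: fx; have : [set [set x]] [set x] by [].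
  by rewrite e.
- by exfalso; apply: (@f0 y x); rewrite -e.
- by exfalso; apply: (@f0 x y); rewrite e.
- congr inr; apply: fx; have : [set [set x]; set0] [set x] by left.
  rewrite e => -[//|e0]; have : [set x] x by [].
  by rewrite e0.
Qed.

Definition saturated L (kappa : Type) (M : structure L) :=
  forall A : set M, card_lt A kappa ->
  forall p : set (formula L (option A)),
  (forall q, finite_set q -> q `<=` p ->
     exists b, forall phi, q phi -> sat (scons b set_val) phi) ->
  exists b, forall phi, p phi -> sat (scons b set_val) phi.

Definition strongly_homogeneous L (kappa : Type) (M : structure L) :=
  forall (I : Type) (a b : I -> M), card_lt I kappa -> same_type a b ->
  exists s : aut M, s \o a = b.

(* [|T|], the number of [L]-formulas, bounds the degree of saturation below;
   together with strong limitness this is all that "sufficiently large" asks. *)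
Definition is_monster L (T : theory L) (kappa : Type) (M : structure L) :=
  [/\ models M T, strong_limit kappa, card_lt (formula L nat) kappa,
      saturated kappa M & strongly_homogeneous kappa M].

Record monsterModel L (T : theory L) := MonsterModel {
  mon :> structure L;
  degree : Type;
  monP : is_monster T degree mon }.

(* A small elementary submodel of [N], presented by its embedding, together
   with a tuple enumerating it. *)
Record smallModel L (T : theory L) (N : monsterModel T) := SmallModel {
  sm :> structure L;
  sm_emb : sm -> N;
  sm_elem : elementary sm_emb;
  idx : Type;
  tup : idx -> sm;
  tup_surj : forall x, exists i, tup i = x;
  idx_small : card_lt idx (degree N) }.

(** * Quotients by cosets *)

(* [quo N] is the quotient by [x ~ y <-> x N = y N]; for a normal subgroup [N],
   its product and unit are those of the quotient group. *)
Section Quotient.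
Variables (G : ChoiceBaseUMagma.type) (N : set G).

Definition coset (x : G) : set G := [set x * n | n in N].

Definition same_coset : rel G := fun x y => `[< coset x = coset y >].

Lemma same_coset_refl : reflexive same_coset.
Proof. by move=> x; apply/asboolP. Qed.
Lemma same_coset_sym : symmetric same_coset.
Proof. by move=> x y; apply/asboolP/asboolP. Qed.
Lemma same_coset_trans : transitive same_coset.
Proof. by move=> y x z /asboolP xy /asboolP yz; apply/asboolP; rewrite xy. Qed.

Canonical same_coset_equiv :=
  EquivRel same_coset same_coset_refl same_coset_sym same_coset_trans.

Definition quo : Type := {eq_quot same_coset}.
HB.instance Definition _ := Choice.on quo.
HB.instance Definition _ := EqQuotient.on quo.
HB.instance Definition _ := hasMul.Build quo
  (fun x y => \pi_quo (repr x * repr y)).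
HB.instance Definition _ := hasOne.Build quo (\pi_quo 1).

End Quotient.

(** * Type spaces and the action of the automorphism group *)

Section TypeSpace.
Variables (L : language) (T : theory L) (N : monsterModel T) (M : smallModel N).

Definition base_tuple : idx M -> N := @sm_emb _ _ _ M \o @tup _ _ _ M.

(* [tp(a/M)] *)
Definition tp (a : idx M -> N) : set (formula L (idx M + M)) :=
  [set phi | sat (scase a (@sm_emb _ _ _ M)) phi].

(* [S_m(M)], the types over [M] of the tuples of [N] that have the same type
   over the empty set as the enumeration [m] of [M] *)
Definition types : set (set (formula L (idx M + M))) :=
  [set tp a | a in [set a | same_type a base_tuple]].

Definition typeSpace : Type := set_type types.
HB.instance Definition _ := Choice.on typeSpace.
HB.instance Definition _ := isSubBaseTopological.Build typeSpace
  setT (fun phi => [set p : typeSpace | set_val p phi]).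

Lemma aut_same_type (s : aut N) I (a : I -> N) : same_type (s \o a) a.
Proof. by move=> phi; symmetry; apply: aut_elementary. Qed.

Lemma types_aut (p : typeSpace) : exists s : aut N, tp (s \o base_tuple) = set_val p.
Proof.
have [a am pE] := set_mem (valP p); rewrite set_valE -pE.
have [_ _ _ _ homN] := monP N.
have [|s <-] := homN _ base_tuple a (idx_small M); last by exists s.
by move=> phi; symmetry; apply: am.
Qed.

Definition tp_aut (s : aut N) : typeSpace :=
  SigSub (mem_set (ex_intro2 _ _ (s \o base_tuple)
    (aut_same_type s base_tuple) erefl) : tp (s \o base_tuple) \in types).

(* [g p = {phi(x, g(b)) : phi(x, b) \in p}] *)
Definition move_type (g : aut M) (p : set (formula L (idx M + M))) :
    set (formula L (idx M + M)) :=
  [set phi | p (fren (scase inl (inr \o aut_inv g)) phi)].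

Lemma move_types (g : aut M) p : types p -> types (move_type g p).
Proof.
case=> a am <-.
have [_ _ _ _ homN] := monP N.
have [||s sg] := homN _ (@sm_emb _ _ _ M) (@sm_emb _ _ _ M \o g).
- exact: (card_lt_surj (@tup_surj _ _ _ M) (idx_small M)).
- move=> phi; rewrite -[sm_emb (s:=M)]/(sm_emb (s:=M) \o id).
  by rewrite -2!sm_elem; apply: aut_elementary.
exists (s \o a) => [phi|]; first by rewrite -am; apply: aut_same_type.
apply/funext => phi; apply/propext.
rewrite /tp /move_type /= sat_ren (aut_elementary s (_ \o _)).
suff -> : s \o (scase a (sm_emb (s:=M)) \o scase inl (inr \o aut_inv g)) =
          scase (s \o a) (sm_emb (s:=M)) by [].
apply/funext => -[i//|x /=].
by have /= -> := congr1 (@^~ (aut_inv g x)) sg; rewrite aut_invK.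
Qed.

Definition act (g : aut M) (p : typeSpace) : typeSpace :=
  SigSub (mem_set (move_types g (set_mem (valP p))) :
    move_type g (set_val p) \in types).

End TypeSpace.

Arguments base_tuple {L T N} M _.
Arguments tp_aut {L T N} M s.

(** * The Lascar Galois group *)

Section Gal.
Variables (L : language) (T : theory L) (N : monsterModel T).

Definition subgroup (G : groupType) (H : set G) :=
  [/\ H 1, forall x y, H x -> H y -> H (x * y) & forall x, H x -> H x^-1].

Definition AutfL : set (aut N) :=
  smallest (@subgroup (aut N))
    [set s | exists M : smallModel N, forall x : M, s (sm_emb x) = sm_emb x].

Definition GalL : Type := quo AutfL.
HB.instance Definition _ := Choice.on GalL.
HB.instance Definition _ := BaseUMagma.on GalL.
HB.instance Definition _ := Quotient.on GalL.

(* The map [tp(s(m)/M) |-> s AutfL]; by [gal_of_typeE] below it does not depend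
   on the choice of [s]. *)
Definition gal_of_type (M : smallModel N) (p : typeSpace M) : GalL :=
  \pi_GalL (sval (cid (types_aut p))).

Lemma AutfL_fix (M : smallModel N) (s : aut N) :
  (forall x : M, s (sm_emb x) = sm_emb x) -> AutfL s.
Proof. by move=> sM; apply: sub_gen_smallest; exists M. Qed.

Lemma AutfL_subgroup : subgroup AutfL.
Proof.
split=> [H [[H1 _ _] _]|x y Hx Hy H HP|x Hx H HP] //.
- by have [_ HM _] := HP.1; apply: HM; [exact: Hx | exact: Hy].
- by have [_ _ HV] := HP.1; apply: HV; exact: Hx.
Qed.

Lemma coset_AutfL (s t : aut N) : AutfL (t^-1 * s) -> coset AutfL s = coset AutfL t.
Proof.
have [H1 HM HV] := AutfL_subgroup => ts; apply/seteqP; split=> _ [n Hn <-].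
  by exists (t^-1 * s * n); [exact: HM | rewrite -mulgA mulVKg].
exists ((t^-1 * s)^-1 * n); first by apply: HM => //; exact: HV.
by rewrite invgM invgK !mulgA mulgV mul1g.
Qed.

Program Definition conj_model (M : smallModel N) (t : aut N) : smallModel N :=
  @SmallModel L T N M (t \o @sm_emb _ _ _ M) _ (idx M) (@tup _ _ _ M)
    (@tup_surj _ _ _ M) (idx_small M).
Next Obligation.
move=> M t V v phi; rewrite (sm_elem v phi); exact: aut_elementary.
Qed.

Lemma gal_of_typeE (M : smallModel N) (p : typeSpace M) (s : aut N) :
  tp (s \o base_tuple M) = set_val p -> gal_of_type p = \pi_GalL s.
Proof.
rewrite /gal_of_type; case: cid => t /= tE sE.
apply/eqmodP/asboolP/coset_AutfL.
have [_ sl _ _ homN] := monP N.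
pose X := scase (t \o base_tuple M) (base_tuple M).
pose Y := scase (s \o base_tuple M) (base_tuple M).
have [||r rE] := homN _ X Y.
- exact: card_lt_sum sl (idx_small M).
- move=> phi.
  have XE q : sat (scase (q \o base_tuple M) (base_tuple M)) phi <->
      tp (q \o base_tuple M) (fren (scase inl (inr \o @tup _ _ _ M)) phi).
    rewrite /tp /= sat_ren.
    suff -> : scase (q \o base_tuple M) (sm_emb (s:=M)) \o
        scase inl (inr \o tup (s:=M)) =
        scase (q \o base_tuple M) (base_tuple M) by [].
    by apply/funext => -[].
  by rewrite /X /Y !XE tE sE.
have rM : forall x : M, r (sm_emb x) = sm_emb x.
  by move=> x; have [i <-] := tup_surj x; exact: (congr1 (@^~ (inr i)) rE).
have rs i : r (t (base_tuple M i)) = s (base_tuple M i).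
  exact: (congr1 (@^~ (inl i)) rE).
have [H1 HM HV] := AutfL_subgroup.
have -> : s^-1 * t = (s^-1 * r^-1 * s) * (s^-1 * (r * t)).
  by rewrite -!mulgA; congr (_ * _); rewrite mulVKg mulKg.
apply: HM.
  apply: (@AutfL_fix (conj_model M s^-1)) => x /=.
  by rewrite aut_invK; congr aut_inv; apply: (can_inj (@aut_funK _ _ r)); rewrite aut_invK rM.
apply: (@AutfL_fix M) => x; have [i <-] := tup_surj x.
by rewrite /= [r _]rs aut_funK.
Qed.

(* [GalL] with the quotient topology given by [S_m(M) -> GalL] *)
Definition galTop (M : smallModel N) : Type := GalL.
HB.instance Definition _ (M : smallModel N) := Choice.on (galTop M).
HB.instance Definition _ (M : smallModel N) := BaseUMagma.on (galTop M).

Section GalTop.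
Variable M : smallModel N.

Definition gal_open (U : set (galTop M)) := open (@gal_of_type M @^-1` U).

Lemma gal_openT : gal_open setT.
Proof. by rewrite /gal_open preimage_setT; exact: openT. Qed.

Lemma gal_openI : setI_closed gal_open.
Proof. by move=> U V; rewrite /gal_open preimage_setI; exact: openI. Qed.

Lemma gal_open_bigU I (f : I -> set (galTop M)) :
  (forall i, gal_open (f i)) -> gal_open (\bigcup_i f i).
Proof.
by move=> H; rewrite /gal_open preimage_bigcup; apply: bigcup_open => i _; exact: H.
Qed.

HB.instance Definition _ := isOpenTopological.Build (galTop M)
  gal_openT gal_openI gal_open_bigU.

End GalTop.
End Gal.

(** * The Ellis semigroup and the Ellis group *)

(* Index sets of nets *)
Record directed := Directed {
  dir :> Type;
  dle : dir -> dir -> Prop;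
  dle_refl : forall d, dle d d;
  dle_trans : forall a b c, dle a b -> dle b c -> dle a c;
  dle_dir : forall a b, exists c, dle a c /\ dle b c;
  dir_inh : inhabited dir }.

(* The net [x] indexed by [D] converges to [l] iff [x @ tails D --> l]. *)
Definition tails (D : directed) : set_system D :=
  [set P | exists d0, forall d, dle d0 d -> P d].

Arguments tails D _ : clear implicits.

#[global] Instance tails_filter (D : directed) : ProperFilter (tails D).
Proof.
split=> [[d0 /(_ d0 (dle_refl d0))] //|]; split.
- by have [d] := dir_inh D; exists d.
- move=> P Q [a Pa] [b Qb]; have [c [ac bc]] := dle_dir a b.
  by exists c => d cd; split; [apply: Pa|apply: Qb]; apply: dle_trans cd.
- by move=> P Q PQ [a Pa]; exists a => d /Pa /PQ.
Qed.

Section DirectedConstructions.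

Program Definition nbhs_dir (X : topologicalType) (x : X) : directed :=
  @Directed {V : set X | nbhs x V} (fun V W => sval W `<=` sval V) _ _ _ _.
Next Obligation. by move=> X x V y. Qed.
Next Obligation. by move=> X x U V W VU WV y /WV /VU. Qed.
Next Obligation.
move=> X x [V nV] [W nW]; exists (exist _ (V `&` W) (filterI nV nW)).
by split=> /= y [].
Qed.
Next Obligation. by move=> X x; split; exists setT; exact: filterT. Qed.

Variables (D : directed) (P : D -> Prop).
Hypothesis cofP : forall d, exists d', dle d d' /\ P d'.

Program Definition cofinal_dir : directed :=
  @Directed {d : D | P d} (fun a b => dle (sval a) (sval b)) _ _ _ _.
Next Obligation. by move=> d; exact: dle_refl. Qed.
Next Obligation. by move=> a b c; exact: dle_trans. Qed.
Next Obligation.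
move=> [a Pa] [b Pb]; have [c [ac bc]] := dle_dir a b.
have [d [cd Pd]] := cofP c; exists (exist _ d Pd).
by split; apply: dle_trans cd.
Qed.
Next Obligation.
by have [d] := dir_inh D; have [d' [_ Pd]] := cofP d; split; exists d'.
Qed.

Lemma tails_cofinal (X : topologicalType) (f : D -> X) (x : X) :
  f @ tails D --> x -> (f \o (sval : cofinal_dir -> D)) @ tails cofinal_dir --> x.
Proof.
move=> fx V /fx[d0 H]; have [d [d0d Pd]] := cofP d0.
exists (exist _ d Pd) => -[e Pe] /= de.
by apply: H; exact: dle_trans de.
Qed.

End DirectedConstructions.

Lemma cvg_precomp (S S' : choiceType) (X : topologicalType) (D : directed)
    (f : D -> S -> X) (p : S -> X) (eta : S' -> S) :
  (f : D -> {ptws S -> X}) @ tails D --> (p : {ptws S -> X}) ->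
  (fun d => f d \o eta : {ptws S' -> X}) @ tails D -->
    (p \o eta : {ptws S' -> X}).
Proof.
move=> fp.
have [_] := @cvg_sup (S' -> X) S' (fun i : S' =>
  Topological.class (initial_topology (fun h : S' -> X => h i)))
  ((fun d => f d \o eta) @ tails D) (p \o eta) _.
apply=> s A; rewrite nbhsE => -[_ [[V oV <-] Vp] VA].
have nV : nbhs (p (eta s)) V by apply: open_nbhs_nbhs.
have /fp[d0 fV] := @proj_continuous S (fun=> X) (eta s) p V nV.
by exists d0 => d /fV; exact: VA.
Qed.

Section Ellis.
Variables (L : language) (T : theory L) (N : monsterModel T) (C : smallModel N).

Local Notation S := (typeSpace C).

(* The elements of [EL] are maps [S -> S]; the product is composition. *)
Definition EL : set {ptws S -> S} :=
  closure [set (@act _ _ _ C g : {ptws S -> S}) | g in setT].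

Definition left_ideal (I : set (S -> S)) :=
  [/\ I !=set0, I `<=` EL & forall x y, EL x -> I y -> I (x \o y)].

Definition minimal_left_ideal (I : set (S -> S)) :=
  left_ideal I /\ forall J, left_ideal J -> J `<=` I -> J = I.

Record minIdealIdem := MinIdealIdem {
  ideal :> set (S -> S);
  ideal_min : minimal_left_ideal ideal;
  idem : S -> S;
  idem_mem : ideal idem;
  idemK : idem \o idem = idem }.

Definition circ (p : S -> S) (A : set (S -> S)) : set (S -> S) :=
  [set eta | EL eta /\
    exists (D : directed) (h : D -> S -> S) (g : D -> aut C),
      [/\ forall d, A (h d),
          (fun d => act (g d) : {ptws S -> S}) @ tails D --> (p : {ptws S -> S}) &
          (fun d => act (g d) \o h d : {ptws S -> S}) @ tails D -->
            (eta : {ptws S -> S})]].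

Variable E : minIdealIdem.
Local Notation u := (idem E).

Definition uM : set (S -> S) := [set u \o m | m in E].

Definition ellisGroup : Type := set_type uM.
HB.instance Definition _ := Choice.on ellisGroup.

Definition ellis_val (x : ellisGroup) : S -> S := set_val x.

Lemma uM_id : uM u.
Proof. by exists u; [exact: idem_mem | exact: idemK]. Qed.

Lemma uM_mul x y : uM x -> uM y -> uM (x \o y).
Proof.
have [[_ sub ide] _] := ideal_min E.
move=> [m Em <-] [n En <-]; exists (m \o (u \o n)) => //.
have Eun : ideal E (u \o n) by exact: (ide _ _ (sub _ (idem_mem E)) En).
exact: (ide _ _ (sub _ Em) Eun).
Qed.

HB.instance Definition _ := hasMul.Build ellisGroup
  (fun x y => SigSub (mem_set (uM_mul (set_mem (valP x)) (set_mem (valP y))))).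
HB.instance Definition _ := hasOne.Build ellisGroup (SigSub (mem_set uM_id)).

Definition cl_tau (A : set ellisGroup) : set ellisGroup :=
  [set eta | circ u (ellis_val @` A) (ellis_val eta)].

Lemma cl_tau0 : cl_tau set0 = set0.
Proof.
rewrite -subset0 => eta [_ [D [h [g [Ah _ _]]]]].
by have [d] := dir_inh D; have [] := Ah d.
Qed.

Lemma cl_tauS A B : A `<=` B -> cl_tau A `<=` cl_tau B.
Proof.
move=> AB eta [ELe [D [h [g [Ah cg ch]]]]]; split=> //.
by exists D, h, g; split=> // d; have [x /AB Bx <-] := Ah d; exists x.
Qed.

Lemma cl_tau_ext A : A `<=` cl_tau A.
Proof.
move=> eta Aeta; have [[_ sub ide] _] := ideal_min E.
have ELu : EL u by apply/sub/idem_mem.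
have [m Em uE] : uM (ellis_val eta) by exact: set_mem (valP eta).
split; first by rewrite -uE; apply: sub; exact: ide.
have ueta : u \o ellis_val eta = ellis_val eta.
  by rewrite -uE compA idemK.
pose D := nbhs_dir (u : {ptws S -> S}).
have gP (d : D) : exists g : aut C, sval d (act g).
  by case: d => V /= /ELu[_ [[g _ <-] Vg]]; exists g.
have [g Vg] := choice gP.
have cg : (fun d => act (g d) : {ptws S -> S}) @ tails D --> (u : {ptws S -> S}).
  move=> V nV; exists (exist _ V nV : D) => d /= Vd.
  by apply: Vd; exact: Vg.
exists D, (fun=> ellis_val eta), g; split=> //.
have := @cvg_precomp S S S D (fun d => act (g d)) u (ellis_val eta) cg.
by rewrite ueta.
Qed.

Lemma cl_tauU A B : cl_tau (A `|` B) `<=` cl_tau A `|` cl_tau B.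
Proof.
move=> eta [ELe [D [h [g [Ah cg ch]]]]].
pose P d := (ellis_val @` A) (h d).
have [cof|/existsNP[d0 nP]] := pselect (forall d, exists d', dle d d' /\ P d').
  left; split=> //; exists (cofinal_dir cof), (h \o sval), (g \o sval).
  split; [by case | exact: tails_cofinal cg | exact: tails_cofinal ch].
have cof d : exists d', dle d d' /\ (ellis_val @` B) (h d').
  have [d' [dd' d0d']] := dle_dir d d0; exists d'; split=> //.
  have [x [Ax|Bx] xh] := Ah d'; last by exists x.
  by case: nP; exists d'; split=> //; exists x.
right; split=> //; exists (cofinal_dir cof), (h \o sval), (g \o sval).
split; [by case | exact: tails_cofinal cg | exact: tails_cofinal ch].
Qed.

(* the sets whose complement is closed under [cl_tau] *)
Definition tau_open (U : set ellisGroup) := cl_tau (~` U) = ~` U.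

Lemma tau_openP U : tau_open U <-> cl_tau (~` U) `<=` ~` U.
Proof.
split=> [-> //|H]; apply/seteqP; split=> //; exact: cl_tau_ext.
Qed.

Lemma tau_openT : tau_open setT.
Proof. by rewrite /tau_open setCT cl_tau0. Qed.

Lemma tau_openI : setI_closed tau_open.
Proof.
move=> U V /tau_openP oU /tau_openP oV; apply/tau_openP.
by rewrite setCI => x /cl_tauU [/oU|/oV]; [left|right].
Qed.

Lemma tau_open_bigU I (f : I -> set ellisGroup) :
  (forall i, tau_open (f i)) -> tau_open (\bigcup_i f i).
Proof.
move=> H; apply/tau_openP => x clx [i _ fix_].
have /tau_openP := H i; move=> /(_ x); apply=> //.
by apply: cl_tauS clx => y nfy fiy; apply: nfy; exists i.
Qed.

(* the tau-topology *)
HB.instance Definition _ := isOpenTopological.Build ellisGroup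
  tau_openT tau_openI tau_open_bigU.

Definition HuM : set ellisGroup :=
  \bigcap_(V in nbhs (1 : ellisGroup)) cl_tau V.

Definition uMH : Type := quotient_topology (quo HuM).
HB.instance Definition _ := Topological.on uMH.
HB.instance Definition _ := Quotient.on uMH.
HB.instance Definition _ := BaseUMagma.copy uMH (quo HuM).

Definition pi0 (x : S -> S) : S := x (tp_aut C 1).

Definition fhat (x : S -> S) : GalL N := gal_of_type (pi0 x).

Definition fbar (x : uMH) : GalL N := fhat (ellis_val (repr x)).

Definition ker_fbar : set uMH := [set x | fbar x = 1].

Definition uMHker : Type := quotient_topology (quo ker_fbar).
HB.instance Definition _ := Topological.on uMHker.
HB.instance Definition _ := Quotient.on uMHker.
HB.instance Definition _ := BaseUMagma.copy uMHker (quo ker_fbar).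

Definition fbar_ind (x : uMHker) : GalL N := fbar (repr x).

End Ellis.

Arguments fbar {L T N C} E _.
Arguments fbar_ind {L T N C} E _.
Arguments HuM {L T N C} E _.

Definition homeomorphism (X Y : topologicalType) (h : X -> Y) :=
  exists k : Y -> X, [/\ cancel h k, cancel k h, continuous h & continuous k].

(* Main.v *)
Require Import Defs.
From HB Require Import structures.
From mathcomp Require Import all_boot finmap.
From mathcomp Require Import all_classical topology.

(** Multiplication in [GalL] is continuous along ultrafilters: if [tp(a_z)],
    [tp(s_z)] and [tp(a_z s_z)] converge, saturation provides one pair [(r, s)]
    realizing all three limits, so the class of the third limit is the product
    of the other two. Applied to automorphisms converging to an element of [EL],
    this makes [fhat] multiplicative and gives the continuity of [f], since a
    point of [cl_tau A] has the class of some limit of the types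
    [a(tp(c))], [a] in [A].

    [f] kills [H(uM)]: the types [tp(s)] such that some [t] satisfies
    [tp(t) = tp(ts)] form a closed set [P] of types of trivial class. If [V] is a
    clopen neighborhood of [P], then [u] is not in the [tau]-closure of
    [{a | a(tp(c)) notin V}], so for [h] in [H(uM)] the class of [h] is the class
    of a limit of types lying in all such [V], that is, in [P].

    For the quotient property, let [f^-1(B)] be [tau]-closed and let [p] be a
    limit of types [x(tp(c))] with class in [B]. The types [uxu(tp(c))] are then
    in the image of [f^-1(B)] and have a limit [q]; by continuity of
    multiplication [q] has the same class as [p], and this class is in [B]
    because [x] in the closure of [A] implies [ux] in [cl_tau A]. *)

Set Implicit Arguments.
Unset Strict Implicit.
Unset Printing Implicit Defensive.

Local Open Scope classical_set_scope.
Local Open Scope quotient_scope.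
Local Open Scope group_scope.
Local Open Scope card_scope.

(** * Realizing types in small tuples of variables *)

Section Formulas.
Variable L : language.

Definition fand V (phi psi : formula L V) := fneg (fimp phi (fneg psi)).

Lemma sat_neg (M : structure L) V (a : V -> M) phi :
  sat a (fneg phi) <-> ~ sat a phi.
Proof. by []. Qed.

Lemma sat_and (M : structure L) V (a : V -> M) phi psi :
  sat a (fand phi psi) <-> sat a phi /\ sat a psi.
Proof.
rewrite /fand sat_neg /=; split=> [/not_implyP[aphi /contrapT]|[aphi apsi] H] //.
exact: H.
Qed.

Lemma term_finite_support V (t : term L V) : exists2 A : set V, finite_set A &
  forall (M : structure L) (a b : V -> M),
    (forall v, A v -> a v = b v) -> teval a t = teval b t.
Proof.
elim: t => [v|f ts IH]; first by exists [set v] => [|M a b /(_ v erefl)].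
have [F Ff FP] := all_sig2 (fun i => cid2 (IH i)).
exists (\bigcup_(i in setT) F i); first exact: bigcup_finite.
move=> M a b ab /=; congr ifun; apply/funext => i; apply: FP => v Fv.
by apply: ab; exists i.
Qed.

(** Variables range over an arbitrary, possibly infinite, type. This lemma supplies the finiteness
    used by compactness, by chain unions and by density of orbits. *)
Lemma formula_finite_support V (phi : formula L V) :
  exists2 A : set V, finite_set A & forall (M : structure L) (a b : V -> M),
    (forall v, A v -> a v = b v) -> sat a phi <-> sat b phi.
Proof.
elim: phi => {V} [V|V s t|V R ts|V phi [A fA AP] psi [B fB BP]|V phi [A fA AP]].
- by exists set0.
- have [A fA AP] := term_finite_support s; have [B fB BP] := term_finite_support t.
  exists (A `|` B) => [|M a b ab]; first by rewrite finite_setU.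
  by rewrite /= (AP M a b) ?(BP M a b) // => v ?; apply: ab; [right|left].
- have [F Ff FP] := all_sig2 (fun i => cid2 (term_finite_support (ts i))).
  exists (\bigcup_(i in setT) F i); first exact: bigcup_finite.
  move=> M a b ab /=; suff -> : (fun i => teval a (ts i)) = (fun i => teval b (ts i)) by [].
  by apply/funext => i; apply: FP => v Fv; apply: ab; exists i.
- exists (A `|` B) => [|M a b ab]; first by rewrite finite_setU.
  by rewrite /= (AP M a b) ?(BP M a b) // => v ?; apply: ab; [right|left].
- exists (Some @^-1` A).
    by apply: finite_preimage => // x y _ _ [].
  move=> M a b ab /=; split=> H x; have := H x; apply AP => -[v /ab|] //= ->.
Qed.

(** A named variable is quantified by renaming it to the bound [None]. The result still has
    variables in [V], but [v] no longer occurs in it. *)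
Definition fex V (v : V) (phi : formula L V) : formula L V :=
  fneg (fall (fneg (fren (fun w => if `[< w = v >] then None else Some w) phi))).

Lemma sat_fex (M : structure L) V (v : V) (a : V -> M) phi :
  sat a (fex v phi) <->
  exists x, sat (fun w => if `[< w = v >] then x else a w) phi.
Proof.
have E x : sat (scons x a) (fren (fun w => if `[< w = v >] then None else Some w) phi)
    <-> sat (fun w => if `[< w = v >] then x else a w) phi.
  rewrite sat_ren; suff -> : scons x a \o (fun w => if `[< w = v >] then None else Some w)
    = fun w => if `[< w = v >] then x else a w by [].
  by apply/funext => w /=; case: ifP.
rewrite /fex sat_neg /=; split=> [/existsNP[x /contrapT /E]|[x /E] H /(_ x)//].
by exists x.
Qed.

Lemma fex_seq V (s : seq {classic V}) (phi : formula L V) :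
  exists psi : formula L V, forall (M : structure L) (a : V -> M),
    sat a psi <->
    exists b, (forall v : V, (v : {classic V}) \notin s -> b v = a v) /\ sat b phi.
Proof.
elim: s phi => [|v s IH] phi.
  exists phi => M a; split=> [|[b [ba]]]; first by exists a.
  by have -> : b = a by apply/funext => v; apply: ba.
have [psi psiP] := IH (fex v phi); exists psi => M a; rewrite psiP.
split=> [[b [ba /sat_fex[x]]]|[b [ba bphi]]].
  exists (fun w => if `[< w = v >] then x else b w); split=> // w.
  rewrite inE negb_or => /andP[wv ws]; case: asboolP => [/eqP|_]; last exact: ba.
  by rewrite (negbTE wv).
exists (fun w => if `[< w = v >] then a v else b w); split.
  move=> w ws; case: asboolP => [->//|wv]; apply: ba.
  by rewrite inE negb_or ws andbT; apply/eqP.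
apply/sat_fex; exists (b v).
suff -> : (fun w => if `[< w = v >] then b v else
    if `[< w = v >] then a v else b w) = b by [].
by apply/funext => w; case: asboolP => [->|].
Qed.

(** Only finitely many variables outside [D] matter to [phi], so finitely many quantifiers suffice
    even when the complement of [D] is infinite. *)
Lemma fex_outside V (D : set V) (phi : formula L V) :
  exists psi : formula L V, forall (M : structure L) (a : V -> M),
    sat a psi <-> exists b, (forall v, D v -> b v = a v) /\ sat b phi.
Proof.
have [A fA AP] := formula_finite_support phi.
have [s sE] := (@finite_seqP {classic V} (A `\` D)).1 (finite_setD D fA).
have [psi psiP] := fex_seq s phi; exists psi => M a; rewrite psiP.
have memE v : ((v : {classic V}) \in s) <-> A v /\ ~ D v.
  by have : [set` s] v <-> (A `\` D) v by rewrite sE.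
split=> -[b [ba bphi]].
  by exists b; split=> // v Dv; apply: ba; apply/negP => /memE[].
exists (fun v => if (v : {classic V}) \in s then b v else a v); split.
  by move=> v /negbTE ->.
apply: (proj1 (AP M b _ _) bphi) => v Av; case: ifP => // /negP vs.
by apply: ba; apply: contrapT => nD; apply: vs; apply/memE.
Qed.

(** Closure under conjunction turns finite satisfiability into satisfiability of single formulas.
    The relation [h] allows the finite set to consist of translations of formulas of [p]. *)
Lemma finite_subset_conjunction (M : structure L) V X (p : set (formula L V)) (h : X -> formula L V -> Prop)
    (q : set X) :
  p (fneg fbot) -> (forall phi psi, p phi -> p psi -> p (fand phi psi)) ->
  finite_set q -> (forall x, q x -> exists2 phi, p phi & h x phi) ->
  exists2 phi, p phi & forall x, q x -> exists2 psi, h x psi &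
    forall a : V -> M, sat a phi -> sat a psi.
Proof.
move=> p1 pand /(@finite_seqP {classic X})[s ->] {q}.
elim: s => [|x s IH] H; first by exists (fneg fbot).
have [|phi pphi IHs] := IH; first by move=> y ys; apply: H; rewrite /= inE ys orbT.
have [|psi ppsi hpsi] := H x; first by rewrite /= inE eqxx.
exists (fand psi phi); first exact: pand.
move=> y; rewrite /= inE => /orP[/eqP ->|/IHs[chi hchi chiP]].
  by exists psi => // a /sat_and[].
by exists chi => // a /sat_and[_ /chiP].
Qed.

End Formulas.

Lemma card_lt_range K X Y (f : X -> Y) (D : set X) :
  card_lt X K -> card_lt [set f x | x in D] K.
Proof.
apply: card_lt_le.
have gP (y : [set f x | x in D]) : exists x, f x = set_val y.
  by have [x _ xE] := set_mem (valP y); exists x.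
have [g gP'] := choice gP; apply: (@inj_card_le_type _ _ g) => y z yz.
by apply: val_inj; apply: etrans (esym (gP' y)) _; rewrite yz; exact: gP'.
Qed.

Section Realize.
Variables (L : language) (kappa : Type) (N : structure L).
Hypothesis satN : saturated kappa N.
Variables (J : Type) (p : set (formula L J)).
Hypothesis smallJ : card_lt J kappa.
Hypothesis p1 : p (fneg fbot).
Hypothesis pand : forall phi psi, p phi -> p psi -> p (fand phi psi).

Let extends (f : J -> option N) (b : J -> N) := forall j x, f j = Some x -> b j = x.

Let good (f : J -> option N) :=
  forall phi, p phi -> exists b, extends f b /\ sat b phi.

(** Saturation is applied to a type in one variable, standing for [i], with the values of [f] as
    parameters; all other undefined variables are quantified away. *)
Let extend_good f i : good f -> f i = None ->
  exists x, good (fun j => if `[< j = i >] then Some x else f j).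
Proof.
move=> gf fi.
have [x0] := dom_inh N.
pose D : set J := [set j | f j <> None].
pose a j := odflt x0 (f j).
have fE j : D j -> f j = Some (a j) by rewrite /D /a /=; case: (f j).
pose A := [set a j | j in D].
have aP j (Dj : D j) : a j \in A by apply/mem_set; exists j.
(* Variables outside [D] other than [i] are also sent to [None]; this is harmless, as satisfaction
   of [exD phi] does not depend on them. *)
pose r j : option A := match pselect (D j) with
  | left Dj => Some (SigSub (aP j Dj)) | right _ => None end.
pose exD (phi : formula L J) := sval (cid (fex_outside (D `|` [set i]) phi)).
have exDP phi (b : J -> N) : sat b (exD phi) <->
    exists c, (forall v, (D `|` [set i]) v -> c v = b v) /\ sat c phi.
  by rewrite /exD; case: cid.
have [||x xP] := @satN A _ [set fren r (exD phi) | phi in p].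
- exact: card_lt_range.
- move=> q fq qp.
  have [|phi pphi phiP] := @finite_subset_conjunction _ N _ _ p (fun chi phi => fren r (exD phi) = chi) q p1 pand fq.
    by move=> chi /qp[phi pphi <-]; exists phi.
  have [b [fb bphi]] := gf _ pphi.
  exists (b i) => chi /phiP[psi <- phipsi]; apply/sat_ren/exDP.
  exists b; split; last exact: phipsi.
  move=> v; rewrite /= /r; case: pselect => /= [Dv _|nD [//|->//]].
  by rewrite set_valE /= (fb _ _ (fE v Dv)).
exists x => phi pphi.
have /sat_ren/exDP[c [cE cphi]] := xP _ (ex_intro2 _ _ phi pphi erefl).
exists c; split=> // j y; case: asboolP => [-> [<-]|ji fj].
  rewrite cE; last by right.
  by rewrite /= /r; case: pselect => // ; rewrite /D /= fi.
have Dj : D j by rewrite /D /= fj.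
rewrite cE; last by left.
rewrite /= /r; case: pselect => // Dj'; rewrite set_valE /=.
by have := fE j Dj; rewrite fj => -[].
Qed.

(** A formula has finite support, and on a finite set the union of a nonempty chain agrees with one
    of its members. The given [f0] serves the empty chain. *)
Let chain_good (A : set (J -> option N)) f0 : good f0 ->
  (forall f, A f -> good f) ->
  (forall f g, A f -> A g -> (forall j x, f j = Some x -> g j = Some x) \/
     (forall j x, g j = Some x -> f j = Some x)) ->
  exists2 g, good g & forall f, A f -> forall j x, f j = Some x -> g j = Some x.
Proof.
move=> gf0 gA totA; have [[f1 Af1]|/forallNP A0] := pselect (exists f, A f); last first.
  by exists f0 => // f /A0.
have uP j : exists o : option N, forall x, o = Some x <-> exists2 f, A f & f j = Some x.
  have [[x [f Af fx]]|H] := pselect (exists x, exists2 f, A f & f j = Some x).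
    exists (Some x) => y; split=> [[<-]|[g Ag gy]]; first by exists f.
    have [/(_ j _ fx)|/(_ j _ gy)] := totA _ _ Af Ag; first by rewrite gy.
    by rewrite fx.
  by exists None => x; split=> // H'; case: H; exists x.
have [g gP] := choice uP; exists g; last first.
  by move=> f Af j x fj; apply/gP; exists f.
move=> phi pphi.
have [B /(@finite_seqP {classic J})[s sE] BP] := formula_finite_support phi.
have [f Af fs] : exists2 f, A f & forall j : J, (j : {classic J}) \in s ->
    forall x, g j = Some x -> f j = Some x.
  elim: s {sE} => [|j s [f Af fs]]; first by exists f1.
  case gj: (g j) => [x|]; last first.
    exists f => // i; rewrite inE => /orP[/eqP ->|/fs //]; by rewrite gj.
  have [h Ah hj] := (gP j x).1 gj.
  have [fh|hf] := totA _ _ Af Ah.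
    exists h => // i; rewrite inE => /orP[/eqP -> y|/fs H y /H /fh //].
    by rewrite gj => -[<-].
  exists f => // i; rewrite inE => /orP[/eqP -> y|/fs //].
  by rewrite gj => -[<-]; apply: hf.
have [b [fb bphi]] := gA _ Af _ pphi.
exists (fun j => odflt (b j) (g j)); split=> [j x -> //|].
apply: (proj1 (BP N b _ _) bphi) => j Bj; case gj : (g j) => [x|//] /=; apply/fb/fs => //.
by have : [set` s] j by rewrite -sE.
Qed.

(** Saturation realizes one element at a time. A whole tuple comes from a maximal good partial
    assignment extending [a] on [D]; by [extend_good] it is total. *)
Lemma realize_tuple (D : set J) (a : J -> N) :
  (forall phi, p phi -> exists b, (forall j, D j -> b j = a j) /\ sat b phi) ->
  exists b, (forall j, D j -> b j = a j) /\ forall phi, p phi -> sat b phi.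
Proof.
move=> Hp.
pose f0 j := if `[< D j >] then Some (a j) else None.
have gf0 : good f0.
  move=> phi /Hp[b [ba bphi]]; exists b; split=> // j x; rewrite /f0.
  by case: asboolP => // Dj [<-]; apply: ba.
pose T := {f | good f /\ forall j x, f0 j = Some x -> f j = Some x}.
pose R (f g : T) := `[< forall j x, sval f j = Some x -> sval g j = Some x >].
have [|||A totA|[f [gf f0f]] fmax] := @Zorn T R.
- by move=> f; apply/asboolP.
- move=> f g h /asboolP fg /asboolP gh; apply/asboolP => j x /fg; exact: gh.
- move=> [f Hf] [g Hg] /asboolP /= fg /asboolP /= gf; apply: eq_exist.
  apply/funext => j; case fj: (f j) => [x|]; first by rewrite (fg _ _ fj).
  by case gj: (g j) => [x|//]; rewrite -fj (gf _ _ gj).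
- have [[f1 Af1]|/forallNP A0] := pselect (exists f, A f); last first.
    by exists (exist _ f0 (conj gf0 (fun _ _ => id))) => f /A0.
  have [|||g gg gA] := @chain_good (sval @` A) f0.
  + exact: gf0.
  + by move=> _ [f _ <-]; have [] := svalP f.
  + move=> _ _ [f Af <-] [g Ag <-].
    by have [/asboolP|/asboolP] := totA f g Af Ag; [left|right].
  have gf j x : f0 j = Some x -> g j = Some x.
    by move=> fj; apply: (gA (sval f1)); [exists f1|apply: (svalP f1).2].
  by exists (exist _ g (conj gg gf)) => f Af; apply/asboolP; apply: gA; exists f.
have fT j : exists x, f j = Some x.
  case fj: (f j) => [x|]; first by exists x.
  have [x gx] := extend_good gf fj.
  pose g k := if `[< k = j >] then Some x else f k.
  have fg k y : f k = Some y -> g k = Some y.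
    by rewrite /g; case: asboolP => // ->; rewrite fj.
  have := fmax (exist _ g (conj gx (fun k y => fg k y \o f0f k y))).
  move=> /(_ _)/(congr1 (fun f => sval f j)) /= H.
  have : g j = f j by apply: H; apply/asboolP.
  by rewrite fj /g; case: asboolP.
have [b bP] := choice fT; exists b; split=> [j Dj|phi pphi].
  have : f0 j = Some (a j) by rewrite /f0; case: asboolP.
  by move=> /f0f; rewrite bP => -[].
have [c [fc cphi]] := gf _ pphi.
by have -> : b = c by apply/funext => j; rewrite (fc _ _ (bP j)).
Qed.

End Realize.

(** * Cardinals and spaces of types *)

(** A maximal partial injection between [X] and [Y] is total on one side: otherwise a pair of points
    missed on both sides could be added. *)
Lemma card_le_total (X Y : Type) :
  [set: X] #<= [set: Y] \/ [set: Y] #<= [set: X].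
Proof.
pose P (G : set (X * Y)) := forall a b, G a -> G b -> a.1 = b.1 <-> a.2 = b.2.
have [F FP totF|G [PG maxG]] := @Zorn_bigcup _ P.
  move=> a b [A FA Aa] [B FB Bb].
  have [/(_ _ Aa) Ba|/(_ _ Bb) Ab] := totF _ _ FA FB; first exact: (FP _ FB).
  exact: (FP _ FA).
have [/choice[f fG]|/existsNP[x nx]] := pselect (forall x, exists y, G (x, y)).
  left; apply: (@inj_card_le_type _ _ f) => x y.
  by have /= := PG _ _ (fG x) (fG y) => -[].
have [/choice[f fG]|/existsNP[y ny]] := pselect (forall y, exists x, G (x, y)).
  right; apply: (@inj_card_le_type _ _ f) => z y.
  by have /= := PG _ _ (fG z) (fG y) => -[].
exfalso; apply: (maxG (G `|` [set (x, y)])).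
  split; first by move=> a; left.
  by move=> /(_ (x, y) (or_intror erefl)) Gxy; apply: nx; exists y.
move=> [a1 a2] [b1 b2] [Ga|[-> ->]] [Gb|[-> ->]] //=; first exact: (PG _ _ Ga Gb).
- by split=> e; [case: nx; exists a2; rewrite -e|case: ny; exists a1; rewrite -e].
- by split=> e; [case: nx; exists b2; rewrite e|case: ny; exists b1; rewrite e].
Qed.

Lemma card_lt_sum2 (K X Y : Type) :
  strong_limit K -> card_lt X K -> card_lt Y K -> card_lt (X + Y)%type K.
Proof.
have sum_le (A B D E : Type) : [set: A] #<= [set: D] -> [set: B] #<= [set: E] ->
    [set: A + B] #<= [set: D + E].
  have ex (U V : Type) : [set: U] #<= [set: V] -> exists f : U -> V, injective f.
    case/card_leP => f; exists (fun x => set_val (f (SigSub (mem_set (I : setT x))))).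
    by move=> x y /val_inj /(inj (in_setT _) (in_setT _)) [].
  move=> /ex[f fI] /ex[g gI].
  apply: (@inj_card_le_type _ _ (scase (inl \o f) (inr \o g))).
  by move=> [a|b] [a'|b'] //= [] => [/fI|/gI] ->.
move=> sl X_K Y_K; have [XY|YX] := card_le_total X Y.
  by apply: card_lt_le (card_lt_sum sl Y_K); exact: sum_le.
by apply: card_lt_le (card_lt_sum sl X_K); exact: sum_le.
Qed.

(** The bound on the number of formulas makes the degree uncountable: the equations between variable
    0 and variable [n] already inject the natural numbers. *)
Lemma card_lt_finite L T (M : structure L) K (X : Type) :
  is_monster T K M -> finite_set [set: X] -> card_lt X K.
Proof.
case=> _ _ + _ _ fX; apply: card_lt_le.
apply: (card_le_trans (finite_set_countable fX)).
by apply: (@inj_card_le_type _ _ (fun n => feq (tvar L 0%N) (tvar L n))) => m n [].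
Qed.

Lemma same_type_le L (M N : structure L) I (a : I -> M) (b : I -> N) :
  (forall phi, sat a phi -> sat b phi) -> same_type a b.
Proof.
move=> ab phi; split=> [/ab //|bphi]; apply: contrapT => /(ab (fneg phi)).
exact.
Qed.

Section TypeTopology.
Variables (L : language) (T : theory L) (N : monsterModel T) (M : smallModel N).
Local Notation S := (typeSpace M).

Lemma typeSpace_rep (p : S) : exists s, p = tp_aut M s.
Proof. by have [s sE] := types_aut p; exists s; apply: val_inj; rewrite /= sE. Qed.

Lemma tp_autP (s : aut N) phi :
  set_val (tp_aut M s) phi <-> sat (scase (s \o base_tuple M) (@sm_emb _ _ _ M)) phi.
Proof. by []. Qed.

Lemma type_neg (p : S) phi : set_val p (fneg phi) <-> ~ set_val p phi.
Proof. by have [s ->] := typeSpace_rep p. Qed.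

Lemma type_and (p : S) phi psi :
  set_val p (fand phi psi) <-> set_val p phi /\ set_val p psi.
Proof. by have [s ->] := typeSpace_rep p; rewrite !tp_autP sat_and. Qed.

Lemma type_true (p : S) : set_val p (fneg fbot).
Proof. by have [s ->] := typeSpace_rep p. Qed.

Lemma open_formula phi : open [set p : S | set_val p phi].
Proof.
exists [set [set p : S | set_val p phi]]; last by rewrite bigcup_set1.
move=> _ ->; exists [fset phi]%fset; first by move=> psi _; rewrite inE.
apply/seteqP; split=> q /= qphi; first by apply: qphi; rewrite /= inE.
by move=> psi; rewrite /= inE => /eqP ->.
Qed.

Lemma closed_formula phi : closed [set p : S | set_val p phi].
Proof.
rewrite (_ : mkset _ = ~` [set p : S | set_val p (fneg phi)]).
  exact/open_closedC/open_formula.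
by apply/seteqP; split=> p /=; rewrite type_neg; [move=> pphi; apply|move/contrapT].
Qed.

(** Conjunctions collapse a finite intersection of subbasic sets to one formula. *)
Lemma nbhs_typeP (p : S) B : nbhs p B <->
  exists2 phi, set_val p phi & forall q : S, set_val q phi -> B q.
Proof.
split=> [|[phi pphi phiB]]; last first.
  apply: (@filterS _ _ _ [set q : S | set_val q phi]) => //.
  by apply: open_nbhs_nbhs; split; [exact: open_formula|].
rewrite nbhsE => -[U [[D Dfin <-] [V DV Vp] UB]].
have [s _ sE] := Dfin _ DV; subst V.
suff [phi pphi phis] : exists2 phi, set_val p phi & forall q : S,
    set_val q phi -> forall psi, psi \in s -> set_val q psi.
  exists phi => // q qphi; apply: UB.
  exists (\bigcap_(i in [set` s]) [set p : S | set_val p i]) => //.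
  by move=> psi /= /phis; apply.
have {Vp DV UB} : forall psi, psi \in enum_fset s -> set_val p psi by move=> psi /Vp.
rewrite [X in _ -> X](_ : _ = exists2 phi, set_val p phi & forall q : S,
    set_val q phi -> forall psi, psi \in enum_fset s -> set_val q psi) //.
elim: (enum_fset s) => [_|psi r IH H].
  by exists (fneg fbot); [exact: type_true|].
have [|phi pphi phiP] := IH; first by move=> chi chir; apply: H; rewrite inE chir orbT.
exists (fand psi phi).
  by apply/type_and; split=> //; apply: H; rewrite mem_head.
move=> q /type_and[qpsi qphi] chi; rewrite inE => /orP[/eqP -> //|].
exact: phiP.
Qed.

Lemma type_cvgP Z (F : set_system Z) {FF : Filter F} (r : Z -> S) (p : S) :
  r @ F --> p <-> forall phi, set_val p phi -> F [set z | set_val (r z) phi].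
Proof.
split=> [rp phi pphi|H B /nbhs_typeP[phi /H Fphi phiB]].
  by apply: (rp [set q : S | set_val q phi]); apply/nbhs_typeP; exists phi.
by apply: (@filterS _ F _ _ (r @^-1` B) _ Fphi) => z /phiB.
Qed.

Lemma type_hausdorff : hausdorff_space S.
Proof.
move=> p q pq; apply: val_inj.
suff H phi : set_val p phi -> set_val q phi.
  apply/seteqP; split=> [//|phi qphi].
  by apply: contrapT => /type_neg /H /type_neg.
move=> pphi; apply: contrapT => /type_neg qphi.
have [r [/= rphi]] := pq [set r : S | set_val r phi] [set r : S | set_val r (fneg phi)]
  ((nbhs_typeP p _).2 (ex_intro2 _ _ phi pphi (fun _ => id)))
  ((nbhs_typeP q _).2 (ex_intro2 _ _ (fneg phi) qphi (fun _ => id))).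
by rewrite type_neg.
Qed.

Lemma type_limit_unique Z (F : set_system Z) {FF : ProperFilter F} (r : Z -> S) (p q : S) :
  r @ F --> p -> r @ F --> q -> p = q.
Proof. by apply: (@cvg_unique _ type_hausdorff). Qed.

(** One inclusion is enough: an ultrafilter decides each formula or its negation, and [p] is
    complete. *)
Lemma ultra_type_cvg Z (F : set_system Z) (UF : UltraFilter F) (r : Z -> S) (p : S) :
  (forall phi, F [set z | set_val (r z) phi] -> set_val p phi) -> r @ F --> p.
Proof.
move=> H; apply/type_cvgP => phi pphi.
have [//|nF] := in_ultra_setVsetC [set z | set_val (r z) phi] UF.
suff /H : F [set z | set_val (r z) (fneg phi)] by rewrite type_neg.
by apply: filterS nF => z /= /type_neg.
Qed.

End TypeTopology.

(** * Simultaneous limits of automorphisms along ultrafilters *)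

Section Limits.
Variables (L : language) (T : theory L) (N : monsterModel T).

(** The formulas true for [F]-almost all [z] form a type in three blocks of variables. Saturation
    realizes it, and homogeneity turns the last two blocks into images of [b] under
    automorphisms. *)
Lemma ultra_limit_tuple (X : Type) (b : X -> N) Z (F : set_system Z)
    (UF : UltraFilter F) (al si : Z -> aut N) : card_lt X (degree N) ->
  exists r s : aut N, forall phi : formula L (X + X + X),
    F [set z | sat (scase (scase b (al z \o b)) ((al z * si z) \o b)) phi] ->
    sat (scase (scase b (r \o b)) ((r * s) \o b)) phi.
Proof.
move=> smallX; have [_ sl _ satN homN] := monP N.
have smallXX : card_lt (X + X + X)%type (degree N).
  by do 2?[apply: card_lt_sum2 => //].
pose t z := scase (scase b (al z \o b)) ((al z * si z) \o b).
pose p : set (formula L (X + X + X)) := [set phi | F [set z | sat (t z) phi]].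
have p1 : p (fneg fbot) by apply: filterS (@filterT _ F _) => z _ /=.
have pand phi psi : p phi -> p psi -> p (fand phi psi).
  by move=> pphi ppsi; apply: filterS (filterI pphi ppsi) => z /= ?; apply/sat_and.
(* Prescribing the first block makes the realization start with [b] itself, as every [t z] does. *)
pose D : set (X + X + X) := [set j | if j is inl (inl _) then True else False].
have [|c [cb cP]] := @realize_tuple L (degree N) N satN _ p smallXX p1 pand D
    (scase (scase b b) b).
  by move=> phi /filter_ex[z zphi]; exists (t z); split=> // -[[]|].
have cE : c \o (inl \o inl) = b by apply/funext => x; exact: (cb (inl (inl x)) I).
have aut_of (h : X -> X + X + X) :
    (forall z, exists s : aut N, t z \o h = s \o b) -> exists s : aut N, s \o b = c \o h.
  move=> H; apply: homN => //; apply: same_type_le => phi bphi.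
  apply/sat_ren/cP; apply: filterS (@filterT _ F _) => z _ /=; apply/sat_ren.
  have [s ->] := H z; exact: (proj1 (aut_elementary s b phi) bphi).
have [|r rE] := aut_of (inl \o inr); first by move=> z; exists (al z).
have [|s sE] := aut_of inr; first by move=> z; exists (al z * si z).
(* At this point [s] sends [b] to the third block, which has to be the image of [b] under the
   product. *)
exists r, (r^-1 * s) => phi /cP; rewrite mulVKg.
suff -> : c = scase (scase b (r \o b)) (s \o b) by [].
by rewrite rE sE; apply/funext => -[[x|//]|//]; exact: (cb (inl (inl x)) I).
Qed.

(** The tuple [b] may contain the enumerations of several models, and the same [r] and [s] then
    serve all of them. *)
Lemma ultra_limit_models (X : Type) (b : X -> N) Z (F : set_system Z)
    (UF : UltraFilter F) (al si : Z -> aut N) : card_lt X (degree N) ->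
  exists r s : aut N, forall (M : smallModel N) (j : idx M -> X),
    b \o j = base_tuple M ->
    [/\ (fun z => tp_aut M (al z)) @ F --> tp_aut M r,
        (fun z => tp_aut M (si z)) @ F --> tp_aut M s &
        (fun z => tp_aut M (al z * si z)) @ F --> tp_aut M (r * s)].
Proof.
move=> smallX; have [r [s rsP]] := ultra_limit_tuple b UF al si smallX.
exists r, s => M j bj.
have [k kP] := choice (@tup_surj _ _ _ M).
have embE : @sm_emb _ _ _ M = b \o (j \o k).
  by rewrite compA bj; apply/funext => x; rewrite /base_tuple /= kP.
have bjE i : b (j i) = base_tuple M i by rewrite -bj.
pose t (u v : aut N) := scase (scase b (u \o b)) (v \o b).
(* Applying [w'] shows that the type of [x(m)] over [M] is read off from the type of [w(m)] over
   [w'(M)], and both of these lie in blocks of the triple. *)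
have tE (u v w w' x : aut N) (h h' : X -> X + X + X) phi : w = w' * x ->
    t u v \o h = w \o b -> t u v \o h' = w' \o b ->
    sat (t u v) (fren (scase (h \o j) (h' \o j \o k)) phi) <->
    set_val (tp_aut M x) phi.
  move=> wE hE h'E; rewrite sat_ren tp_autP (aut_elementary w' (scase _ _)).
  set a := _ \o _; set a' := _ \o _; suff -> : a = a' by [].
  apply/funext => -[i|y]; rewrite /a /a' /=.
    by rewrite -bjE -[w' _]/((w' * x) (b (j i))) -wE; exact: (congr1 (@^~ (j i)) hE).
  by rewrite embE; exact: (congr1 (@^~ (j (k y))) h'E).
have lim (h h' : X -> X + X + X) (w w' x : aut N -> aut N -> aut N) :
    (forall u v, w u v = w' u v * x u v) ->
    (forall u v, t u (u * v) \o h = w u v \o b) ->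
    (forall u v, t u (u * v) \o h' = w' u v \o b) ->
    (fun z => tp_aut M (x (al z) (si z))) @ F --> tp_aut M (x r s).
  move=> wE hE h'E; apply: ultra_type_cvg => phi H.
  apply/(tE _ _ _ _ _ _ _ _ (wE r s) (hE r s) (h'E r s)).
  apply: rsP; apply: filterS H => z Hz.
  by apply/(tE _ _ _ _ _ _ _ _ (wE _ _) (hE _ _) (h'E _ _)).
split.
- by apply: (lim (inl \o inr) (inl \o inl) (fun u _ => u) (fun _ _ => 1)) => // u v; rewrite mul1g.
- by apply: (lim inr (inl \o inr) (fun u v => u * v) (fun u _ => u)).
- by apply: (lim inr (inl \o inl) (fun u v => u * v) (fun _ _ => 1)) => // u v; rewrite mul1g.
Qed.

Lemma ultra_limit (M : smallModel N) Z (F : set_system Z)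
    (UF : UltraFilter F) (al si : Z -> aut N) :
  exists r s : aut N,
    [/\ (fun z => tp_aut M (al z)) @ F --> tp_aut M r,
        (fun z => tp_aut M (si z)) @ F --> tp_aut M s &
        (fun z => tp_aut M (al z * si z)) @ F --> tp_aut M (r * s)].
Proof.
have [r [s H]] := ultra_limit_models (base_tuple M) UF al si (idx_small M).
by exists r, s; exact: (H M id).
Qed.

Lemma type_compact (M : smallModel N) Z (F : set_system Z)
    (UF : UltraFilter F) (r : Z -> typeSpace M) : exists p : typeSpace M, r @ F --> p.
Proof.
have [s rE] := choice (fun z => typeSpace_rep (r z)).
have [a [_ [sa _ _]]] := ultra_limit M UF s (fun=> 1).
by exists (tp_aut M a); rewrite (_ : r = fun z => tp_aut M (s z)) //; apply/funext.
Qed.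

End Limits.

(** * The Galois group *)

Lemma closure_ultra (X : topologicalType) (A : set X) (x : X) :
  closure A x -> exists F : set_system X, [/\ UltraFilter F, F A & F --> x].
Proof.
rewrite closureEcvg => -[G PG [Gx GA]]; have [F [UF GF]] := ultraFilterLemma PG.
exists F; split=> //; first by apply: GF; apply: GA => y.
by move=> B /Gx /GF.
Qed.

Lemma pi_quoE (G : ChoiceBaseUMagma.type) (H : set G) (x y : G) :
  \pi_(quo H) x = \pi_(quo H) y <-> coset H x = coset H y.
Proof. by split=> [/eqmodP/asboolP|e]; last by apply/eqmodP/asboolP. Qed.

Section GaloisGroup.
Variables (L : language) (T : theory L) (N : monsterModel T).

(** The conjugate by [t] of an automorphism fixing [M] fixes the model [t(M)], so the elements with
    conjugate in [AutfL] form a subgroup containing the generators. *)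
Lemma AutfL_conj (s t : aut N) : AutfL s -> AutfL (t * s * t^-1).
Proof.
have [H1 HM HV] := AutfL_subgroup N.
pose H : set (aut N) := [set x | AutfL (t * x * t^-1)].
move=> As; apply: (As H); split.
  split=> [|x y|x]; rewrite /H /=.
  - by rewrite mulg1 mulgV.
  - move=> Hx Hy; have := HM _ _ Hx Hy.
    by rewrite -!mulgA mulKg.
  - by move=> /HV; rewrite !invgM invgK mulgA.
move=> x [M xM]; apply: (@AutfL_fix _ _ _ (conj_model M t)) => y.
by rewrite /= aut_funK; congr (t _); exact: xM.
Qed.

Lemma pi_galE (s t : aut N) : \pi_(GalL N) s = \pi_(GalL N) t <-> AutfL (t^-1 * s).
Proof.
have [H1 _ _] := AutfL_subgroup N.
rewrite pi_quoE; split=> [st|]; last exact: coset_AutfL.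
have [n Hn <-] : coset (@AutfL _ _ N) t s by rewrite -st; exists 1; rewrite ?mulg1.
by rewrite mulKg.
Qed.

(** The product of classes is defined through [repr]; normality removes the dependence on the chosen
    representatives. *)
Lemma pi_galM (s t : aut N) : \pi_(GalL N) (s * t) = \pi_(GalL N) s * \pi_(GalL N) t.
Proof.
have [H1 HM HV] := AutfL_subgroup N.
have rep (x : aut N) : AutfL ((repr (\pi_(GalL N) x))^-1 * x).
  by apply/pi_galE; rewrite reprK.
apply/pi_galE; move: (repr _) (rep s) => s'; move: (repr _) (rep t) => t' Ht Hs.
have -> : (s' * t')^-1 * (s * t) = (t'^-1 * t) * (t^-1 * (s'^-1 * s) * t^-1^-1).
  by rewrite invgM invgK -!mulgA mulVKg.
by apply: HM => //; exact: AutfL_conj.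
Qed.

Lemma pi_gal1 : \pi_(GalL N) 1 = 1. Proof. by []. Qed.

Lemma gal_surj (y : GalL N) : exists s, y = \pi_(GalL N) s.
Proof. by exists (repr y); rewrite reprK. Qed.

Lemma gal_mul1 (y : GalL N) : y * 1 = y.
Proof. by have [s ->] := gal_surj y; rewrite -pi_gal1 -pi_galM mulg1. Qed.

Lemma gal_1mul (y : GalL N) : 1 * y = y.
Proof. by have [s ->] := gal_surj y; rewrite -pi_gal1 -pi_galM mul1g. Qed.

Lemma gal_mulI (x y z : GalL N) : x * y = x * z -> y = z.
Proof.
have [s ->] := gal_surj x; have [t ->] := gal_surj y; have [r ->] := gal_surj z.
rewrite -!pi_galM => /pi_galE H; apply/pi_galE.
by rewrite invgM -!mulgA mulKg in H.
Qed.

Lemma gal_tp (M : smallModel N) (s : aut N) : gal_of_type (tp_aut M s) = \pi_(GalL N) s.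
Proof. exact: gal_of_typeE. Qed.

(* The types [p] and [q] do not determine [r], but their classes determine its
   class: multiplication is continuous in the Galois group. *)
Lemma gal_limit_mul (M : smallModel N) Z (F : set_system Z) (UF : UltraFilter F)
    (al si : Z -> aut N) (p q r : typeSpace M) :
  (fun z => tp_aut M (al z)) @ F --> p ->
  (fun z => tp_aut M (si z)) @ F --> q ->
  (fun z => tp_aut M (al z * si z)) @ F --> r ->
  gal_of_type r = gal_of_type p * gal_of_type q.
Proof.
have [a [s [la ls las]]] := ultra_limit M UF al si => lp lq lr.
rewrite (type_limit_unique lp la) (type_limit_unique lq ls) (type_limit_unique lr las).
by rewrite !gal_tp pi_galM.
Qed.

Lemma gal_closedP (M : smallModel N) (B : set (galTop M)) :
  closed B <-> closed [set p : typeSpace M | B (gal_of_type p)].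
Proof. by rewrite -!openC. Qed.

(** Concatenating the two enumerations gives one automorphism [r] whose types over [M] and over [M']
    are both limits of those of the same [s z]. *)
Lemma gal_closed_independent (M M' : smallModel N) (B : set (GalL N)) :
  closed [set p : typeSpace M | B (gal_of_type p)] ->
  closed [set p : typeSpace M' | B (gal_of_type p)].
Proof.
move=> cB p /closure_ultra[F [UF FB Fp]].
have [s sE] := choice (@typeSpace_rep _ _ _ M').
have [_ sl _ _ _] := monP N.
have [r [r' H]] := ultra_limit_models (scase (base_tuple M) (base_tuple M')) UF s
  (fun=> 1) (card_lt_sum2 sl (idx_small M) (idx_small M')).
have [lM _ _] := H M inl erefl; have [lM' _ _] := H M' inr erefl.
have sid : (fun z => tp_aut M' (s z)) = id by apply/funext => z; rewrite -sE.
have pE : p = tp_aut M' r by apply: (@type_limit_unique _ _ _ M' _ F _ id) => //; rewrite -sid.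
rewrite pE.
rewrite /= gal_tp -(gal_tp M).
apply: (closed_cvg _ cB _ _ lM); apply: filterS FB => z /=.
by rewrite {1}(sE z) !gal_tp.
Qed.

End GaloisGroup.

(** * The Ellis semigroup *)

Section Pointwise.
Variables (I : choiceType) (X : topologicalType).

Lemma ptws_cvgP Z (F : set_system Z) {FF : Filter F} (f : Z -> I -> X) (p : I -> X) :
  (f : Z -> {ptws I -> X}) @ F --> (p : {ptws I -> X}) <->
  forall i, (fun z => f z i) @ F --> p i.
Proof.
split=> [fp i|H].
  move=> V nV; exact: (fp _ (@proj_continuous I (fun=> X) i p V nV)).
have [_] := @cvg_sup (I -> X) I (fun i : I =>
  Topological.class (initial_topology (fun h : I -> X => h i))) (f @ F) p _.
apply=> i A; rewrite nbhsE => -[_ [[V oV <-] Vp] VA].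
have nV : nbhs (p i) V by apply: open_nbhs_nbhs.
by apply: (@filterS _ F _ _ (f @^-1` A) _ (H i V nV)) => z /VA.
Qed.

Lemma ptws_precomp (x : I -> X) (y : I -> I) (W : set {ptws I -> X}) :
  nbhs (x \o y : {ptws I -> X}) W ->
  nbhs (x : {ptws I -> X}) [set x' : {ptws I -> X} | W (x' \o y)].
Proof.
suff H : (fun x' : {ptws I -> X} => x' \o y : {ptws I -> X}) @ nbhs (x : {ptws I -> X})
    --> (x \o y : {ptws I -> X}) by move=> /H.
apply/ptws_cvgP => i /=.
exact: (@proj_continuous I (fun=> X) (y i) x).
Qed.

(** Unlike precomposition, this needs [x] continuous. It is applied only to maps [act g]; elements
    of [EL] have to be approximated by these first. *)
Lemma ptws_postcomp (x : X -> X) (y : I -> X) (W : set {ptws I -> X}) :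
  continuous x -> nbhs (x \o y : {ptws I -> X}) W ->
  nbhs (y : {ptws I -> X}) [set y' : {ptws I -> X} | W (x \o y')].
Proof.
move=> cx.
suff H : (fun y' : {ptws I -> X} => x \o y' : {ptws I -> X}) @ nbhs (y : {ptws I -> X})
    --> (x \o y : {ptws I -> X}) by move=> /H.
apply/ptws_cvgP => i /=.
apply: continuous_cvg; first exact: cx.
exact: (@proj_continuous I (fun=> X) i y).
Qed.

End Pointwise.

(** * The action of automorphisms on types and its closure *)

Section Action.
Variables (L : language) (T : theory L) (N : monsterModel T) (C : smallModel N).
Local Notation S := (typeSpace C).
Local Notation emb := (@sm_emb _ _ _ C).

Lemma aut_lift (g : aut C) : exists s : aut N, s \o emb = emb \o g.
Proof.
have [_ _ _ _ homN] := monP N; apply: homN.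
  exact: (card_lt_surj (@tup_surj _ _ _ C) (idx_small C)).
by move=> phi; rewrite -[emb]/(emb \o id) -2!sm_elem; apply: aut_elementary.
Qed.

(** This replaces the syntactic action on formulas by multiplication in [aut N], to which
    [ultra_limit] applies. *)
Lemma act_tp (g : aut C) (s t : aut N) : s \o emb = emb \o g ->
  act g (tp_aut C t) = tp_aut C (s * t).
Proof.
move=> sg; suff H phi : set_val (act g (tp_aut C t)) phi <-> set_val (tp_aut C (s * t)) phi.
  by apply/val_inj/funext => phi; apply/propext; exact: H.
apply: iff_trans (sat_ren _ _ _) _; rewrite (aut_elementary s (_ \o _)) tp_autP.
suff -> : s \o (scase (t \o base_tuple C) emb \o scase inl (inr \o aut_inv g)) =
          scase (s * t \o base_tuple C) emb by [].
apply/funext => -[i//|x /=].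
by have /= -> := congr1 (@^~ (aut_inv g x)) sg; rewrite aut_invK.
Qed.

Lemma act_mul (g h : aut C) : act (g * h) = act g \o @act _ _ _ C h.
Proof.
have [s sg] := aut_lift g; have [t th] := aut_lift h.
apply/funext => p; have [r ->] := typeSpace_rep p.
rewrite /= (act_tp r th) (act_tp _ sg) mulgA; apply: act_tp.
apply/funext => x; rewrite /=.
by have /= -> := congr1 (@^~ x) th; exact: (congr1 (@^~ (h x)) sg).
Qed.

Lemma act_continuous (g : aut C) : continuous (@act _ _ _ C g).
Proof.
move=> p; apply: (proj2 (@type_cvgP _ _ _ C _ (nbhs p) _ (act g) _)) => phi pphi.
by apply/nbhs_typeP; exists (fren (scase inl (inr \o aut_inv g)) phi).
Qed.

Lemma finite_set_type (U : Type) (A : set U) : finite_set A -> finite_set [set: A].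
Proof. by move=> fA; rewrite (eq_finite_set (card_setT A)). Qed.

(** A formula of [p] involves finitely many coordinates and parameters. Suitable values for these
    coordinates are found inside [C], and homogeneity of [C] moves the enumeration there. *)
Lemma act_dense (kappa : Type) (p : S) (U : set S) : is_monster T kappa C ->
  nbhs p U -> exists g : aut C, U (act g (tp_aut C 1)).
Proof.
move=> hC /nbhs_typeP[phi + phiU].
suff H : set_val p phi -> exists g : aut C, set_val (act g (tp_aut C 1)) phi.
  by move=> /H[g /phiU]; exists g.
have [s ->] := typeSpace_rep p => /tp_autP sphi.
have [A fA AP] := formula_finite_support phi.
have [_ _ _ satC homC] := hC.
have [x0] := dom_inh C.
(* [None] absorbs the variables outside the support [A]. The set [D] prescribes it together with the
   parameters, leaving the coordinates of the tuple free. *)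
pose J := option A.
pose r (v : idx C + C) : J := match pselect (v \in A) with
  | left vA => Some (SigSub vA) | right _ => None end.
pose w (j : J) : N := if j is Some v then scase (s \o base_tuple C) emb (set_val v)
  else emb x0.
pose a (j : J) : C := if j is Some v then
  match set_val v with inl _ => x0 | inr x => x end else x0.
pose D : set J := [set j | if j is Some v then
  match set_val v with inl _ => False | inr x => True end else True].
pose q : set (formula L J) := [set psi | sat w psi].
have rE v : A v -> exists vA : v \in A, r v = Some (SigSub vA).
  move=> Av; rewrite /r; case: pselect => [vA|]; first by exists vA.
  by case; exact: mem_set.
have smallJ : card_lt J kappa.
  apply: (card_lt_finite hC).
  rewrite (_ : setT = [set None] `|` Some @` setT); last first.
    by apply/seteqP; split=> // -[v _|]; [right; exists v|left].
  by rewrite finite_setU; split=> //; apply: finite_image; exact: finite_set_type.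
have q1 : q (fneg fbot) by [].
have qand psi chi : q psi -> q chi -> q (fand psi chi).
  by move=> ? ?; apply/sat_and.
have [|b [bD bP]] := @realize_tuple _ _ _ satC _ q smallJ q1 qand D a.
  (* With the free coordinates quantified away, only elements of [C] remain, so elementarity
     transfers the formula from [N] to [C]. *)
  move=> psi qpsi; have [chi chiP] := fex_outside D psi.
  apply/chiP/sm_elem/chiP; exists w; split=> // -[v|//].
  by rewrite /D /w /a /=; case: (set_val v).
pose I0 := set_type [set i | A (inl i)].
have fI0 : finite_set [set: I0].
  apply: finite_set_type; apply: finite_preimage => //.
  by move=> ? ? _ _ [].
have [||g gE] := homC I0 (@tup _ _ _ C \o set_val) (b \o r \o (inl \o set_val)).
- exact: card_lt_finite hC fI0.
- apply: same_type_le => psi tpsi.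
  apply/(sat_ren (r \o (inl \o set_val)) b)/bP/sat_ren.
  have -> : w \o (r \o (inl \o set_val)) =
      s \o (emb \o (@tup _ _ _ C \o (set_val : I0 -> _))).
    apply/funext => i /=; have [vA ->] := rE _ (set_mem (valP i)).
    by rewrite /w /=.
  exact/(proj1 (aut_elementary s _ psi))/(proj1 (sm_elem _ psi)).
exists g; have [t tg] := aut_lift g.
rewrite (act_tp _ tg) mulg1 tp_autP.
have -> : scase (t \o base_tuple C) emb =
    emb \o scase (g \o @tup _ _ _ C) id.
  by apply/funext => -[i|x //] /=; exact: (congr1 (@^~ (tup i)) tg).
apply/sm_elem; have : sat b (fren r phi).
  apply/bP/sat_ren; apply: (proj1 (AP N _ _ _) sphi) => v Av /=.
  by have [vA ->] := rE v Av.
move=> /sat_ren; apply: (proj1 (AP C _ _ _)) => -[i|x] Av /=.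
  exact: (esym (congr1 (@^~ (SigSub (mem_set (Av : [set i | A (inl i)] i)))) gE)).
by have [vA ->] := rE _ Av; rewrite bD.
Qed.

Lemma EL_ultra (x : S -> S) : EL x -> exists (F : set_system (S -> S)) (g : (S -> S) -> aut C),
  UltraFilter F /\ forall p, (fun z => act (g z) p) @ F --> x p.
Proof.
move=> /closure_ultra[F [UF FA Fx]].
have gP (z : S -> S) : exists g : aut C, [set act g | g in setT] z -> act g = z.
  have [[g _ <-]|nz] := pselect ([set @act _ _ _ C g | g in setT] z); first by exists g.
  by exists 1.
have [g gE] := choice gP; exists F, g; split=> // p.
apply: cvg_trans ((ptws_cvgP (id : (S -> S) -> S -> S) x).1 Fx p).
apply: near_eq_cvg; apply: filterS FA => z /gE /= zE.
by rewrite zE.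
Qed.

Lemma EL_limit Z (F : set_system Z) {FF : ProperFilter F} (y : Z -> S -> S) (x : S -> S) :
  F [set z | EL (y z)] -> (forall p, (fun z => y z p) @ F --> x p) -> EL x.
Proof.
move=> Fy yx; apply: (@closed_cvg _ _ F _ (y : Z -> {ptws S -> S}) (@EL _ _ _ C)) => //.
  exact: closed_closure.
exact: (ptws_cvgP y x).2.
Qed.

Lemma EL_act (g : aut C) : EL (@act _ _ _ C g).
Proof. by apply: subset_closure; exists g. Qed.

(** Lifts of automorphisms tending to [x] are multiplied by a fixed representative of [q], and
    [ultra_limit] is applied to both factors. *)
Lemma EL_rep (x : S -> S) (q : S) : EL x -> exists r s : aut N,
  [/\ tp_aut C r = x (tp_aut C 1), tp_aut C s = q & tp_aut C (r * s) = x q].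
Proof.
move=> /EL_ultra[F [g [UF gx]]].
have [l lE] := choice aut_lift; have [s0 ->] := typeSpace_rep q.
have [r [s [lr ls lrs]]] := ultra_limit C UF (l \o g) (fun=> s0).
exists r, s; split.
- apply: type_limit_unique lr _; rewrite /=.
  under eq_fun do rewrite -[l _]mulg1 -(act_tp 1 (lE (g _))).
  exact: gx.
- by apply: type_limit_unique ls _; exact: cvg_cst.
- apply: type_limit_unique lrs _; rewrite /=.
  under eq_fun do rewrite -(act_tp s0 (lE (g _))).
  exact: gx.
Qed.

Lemma EL_surj (kappa : Type) (p : S) : is_monster T kappa C ->
  exists2 x, EL x & x (tp_aut C 1) = p.
Proof.
move=> hC; have : closure [set act g (tp_aut C 1) | g in [set: aut C]] p.
  by move=> B /(act_dense hC)[g Bg]; exists (act g (tp_aut C 1)); split=> //; exists g.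
move=> /closure_ultra[F [UF FA Fp]].
have gP (z : S) : exists g : aut C,
    [set act g (tp_aut C 1) | g in [set: aut C]] z -> act g (tp_aut C 1) = z.
  have [[g _ <-]|nz] := pselect ([set act g (tp_aut C 1) | g in [set: aut C]] z).
    by exists g.
  by exists 1.
have [g gE] := choice gP.
have [x xP] := choice (fun q => type_compact UF (fun z => act (g z) q)).
exists x; first by apply: EL_limit xP; apply: filterS (@filterT _ F _) => z _; exact: EL_act.
apply: type_limit_unique (xP _) _.
apply: cvg_trans Fp; apply: near_eq_cvg; apply: filterS FA => z /gE /= ->.
by [].
Qed.

End Action.

(** * The Ellis group and its tau-topology *)

Section EllisGroup.
Variables (L : language) (T : theory L) (N : monsterModel T) (C : smallModel N).
Local Notation S := (typeSpace C).
Local Notation PS := {ptws S -> S}.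

Let post (g : aut C) (y : S -> S) (W : set PS) : nbhs (act g \o y : PS) W ->
  nbhs (y : PS) [set y' : PS | W (act g \o y')].
Proof. exact: ptws_postcomp (@act_continuous _ _ _ _ g). Qed.

Lemma nbhs_nbhs (x : PS) (U : set PS) : nbhs x U -> nbhs x [set y : PS | nbhs y U].
Proof. by move=> /nbhs_interior. Qed.

Lemma nbhs_precomp (x y : S -> S) (U : set PS) : nbhs (x \o y : PS) U ->
  nbhs (x : PS) [set x' : PS | nbhs (x' \o y : PS) U].
Proof. by move=> /nbhs_nbhs /ptws_precomp. Qed.

Lemma EL_nbhs (x : S -> S) (U : set PS) : nbhs (x : PS) U -> EL x ->
  exists g : aut C, U (act g).
Proof. by move=> nU /(_ U nU)[_ [[g _ <-] Ug]]; exists g. Qed.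

(** The order matters: [x] is replaced by some [act g] while [y] is fixed, and only then [y], using
    that [act g] is continuous. *)
Lemma EL_comp (x y : S -> S) : EL x -> EL y -> EL (x \o y).
Proof.
move=> ELx ELy B /nbhs_nbhs /ptws_precomp /EL_nbhs /(_ ELx)[g] /= /post.
move=> /EL_nbhs /(_ ELy)[h] /=.
by rewrite -act_mul => Bgh; exists (act (g * h)); split=> //; exists (g * h).
Qed.

Variable E : minIdealIdem C.
Local Notation u := (idem E).
Local Notation G := (ellisGroup E).

Lemma ideal_EL m : ideal E m -> EL m.
Proof. by have [[_ sub _] _] := ideal_min E; exact: sub. Qed.

Lemma ideal_comp x m : EL x -> ideal E m -> ideal E (x \o m).
Proof. by have [[_ _ ide] _] := ideal_min E; exact: ide. Qed.

Lemma EL_idem : EL u.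
Proof. exact/ideal_EL/idem_mem. Qed.

(** The multiples of [a] by [EL] form a left ideal inside the minimal one. *)
Lemma ideal_principal a m : ideal E a -> ideal E m -> exists2 x, EL x & x \o a = m.
Proof.
move=> Ea Em; have [_ minE] := ideal_min E.
have JE : [set x \o a | x in @EL _ _ _ C] = ideal E.
  apply: minE; last by move=> _ [x ELx <-]; exact: ideal_comp.
  split; first by exists (u \o a), u => //; exact: EL_idem.
    by move=> _ [x ELx <-]; apply: EL_comp => //; exact: ideal_EL.
  by move=> x _ ELx [y ELy <-]; exists (x \o y) => //; exact: EL_comp.
have [x ELx xa] : [set x \o a | x in @EL _ _ _ C] m by rewrite JE.
by exists x.
Qed.

Lemma ideal_idem m : ideal E m -> m \o u = m.
Proof.
move=> Em; have [x _ <-] := ideal_principal (idem_mem E) Em.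
by rewrite -compA idemK.
Qed.

Lemma ellis_ideal (a : G) : ideal E (ellis_val a).
Proof.
have [m Em mE] := set_mem (valP a); rewrite /ellis_val set_valE -mE.
exact: ideal_comp EL_idem Em.
Qed.

Lemma ellis_EL (a : G) : EL (ellis_val a).
Proof. exact/ideal_EL/ellis_ideal. Qed.

Lemma ellis_u_val (a : G) : u \o ellis_val a = ellis_val a.
Proof.
have [m Em mE] := set_mem (valP a); rewrite /ellis_val set_valE -mE.
by rewrite compA idemK.
Qed.

Lemma ellis_val_u (a : G) : ellis_val a \o u = ellis_val a.
Proof. exact/ideal_idem/ellis_ideal. Qed.

Lemma ellis_val_inj : injective (@ellis_val _ _ _ _ E).
Proof. exact: val_inj. Qed.

Lemma ellis_valM (a b : G) : ellis_val (a * b) = ellis_val a \o ellis_val b.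
Proof. by []. Qed.

Lemma ellis_val1 : ellis_val (1 : G) = u. Proof. by []. Qed.

Lemma ellis_of_ideal m : ideal E m -> exists a : G, ellis_val a = u \o m.
Proof. by move=> Em; exists (SigSub (mem_set (ex_intro2 _ _ m Em erefl : uM E _))). Qed.

Lemma ellis_mulA (a b c : G) : a * (b * c) = a * b * c.
Proof. by apply: ellis_val_inj; rewrite !ellis_valM. Qed.

Lemma ellis_mul1 (a : G) : a * 1 = a.
Proof. by apply: ellis_val_inj; rewrite ellis_valM ellis_val_u. Qed.

Lemma ellis_1mul (a : G) : 1 * a = a.
Proof. by apply: ellis_val_inj; rewrite ellis_valM ellis_u_val. Qed.

Lemma ellis_inverse (a : G) : exists b : G, b * a = 1 /\ a * b = 1.
Proof.
have left_inv (c : G) : exists b : G, b * c = 1.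
  have [x ELx xc] := ideal_principal (ellis_ideal c) (idem_mem E).
  have [b bE] := ellis_of_ideal (ideal_comp ELx (idem_mem E)).
  exists b; apply: ellis_val_inj; rewrite ellis_valM bE ellis_val1.
  rewrite -[LHS]/(u \o (x \o (u \o ellis_val c))).
  by rewrite ellis_u_val xc idemK.
have [b ba] := left_inv a; have [c cb] := left_inv b.
exists b; split=> //; suff -> : a = c by [].
by rewrite -[a]ellis_1mul -cb -ellis_mulA ba ellis_mul1.
Qed.

(** Nets are traded for neighborhoods. In the converse, the net is indexed by neighborhoods of the
    pair in the product, so one index controls both limits. *)
Lemma cl_tau_nbhs (A : set G) (eta : G) : cl_tau A eta <->
  forall (U W : set PS), nbhs (u : PS) U -> nbhs (ellis_val eta : PS) W ->
    exists (g : aut C) (a : G), [/\ A a, U (act g) & W (act g \o ellis_val a)].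
Proof.
split=> [[_ [D [h [g [Ah gu gh]]]]] U W nU nW|H].
  have [d [Ud Wd]] := filter_ex (@filterI _ (tails D) _ [set d | U (act (g d))]
    [set d | W (act (g d) \o h d)] (gu _ nU) (gh _ nW)).
  by have [a Aa ah] := Ah d; exists (g d), a; split=> //; rewrite ah.
split; first exact: ellis_EL.
pose D := nbhs_dir ((u, ellis_val eta) : PS * PS).
have ga (d : D) : exists x : aut C * G, A x.2 /\
    sval d (act x.1 : PS, act x.1 \o ellis_val x.2 : PS).
  case: d => V /= [[U W] /= [nU nW] UWV].
  have [g [a [Aa Ug Wga]]] := H U W nU nW; exists (g, a); split=> //.
  exact: UWV.
have [x xP] := choice ga.
exists D, (fun d => ellis_val (x d).2), (fun d => (x d).1); split.
- by move=> d; exists (x d).2 => //; case: (xP d).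
- move=> U nU; have nV : nbhs ((u, ellis_val eta) : PS * PS) [set z | U z.1].
    by exists (U, setT); [split=> //; exact: filterT|case=> a b []].
  by exists (exist _ _ nV : D) => d /(_ _ (xP d).2).
- move=> W nW; have nV : nbhs ((u, ellis_val eta) : PS * PS) [set z | W z.2].
    by exists (setT, W); [split=> //; exact: filterT|case=> a b []].
  by exists (exist _ _ nV : D) => d /(_ _ (xP d).2).
Qed.

(** Elements of [EL] may stand in for automorphisms: with [a] fixed, precomposition is continuous
    and [x] can be approximated. *)
Lemma cl_tau_EL (A : set G) (eta : G) :
  (forall (U W : set PS), nbhs (u : PS) U -> nbhs (ellis_val eta : PS) W ->
    exists (x : S -> S) (a : G), [/\ EL x, A a & nbhs (x : PS) U /\
      nbhs (x \o ellis_val a : PS) W]) ->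
  cl_tau A eta.
Proof.
move=> H; apply/cl_tau_nbhs => U W nU nW.
have [x [a [ELx Aa [nx /ptws_precomp nxa]]]] := H U W nU nW.
by have [g [Ug Wg]] := EL_nbhs (filterI nx nxa) ELx; exists g, a.
Qed.

(** Idempotence of [u] lets [g] be chosen with [act g \o u] still close to [u]; then [h] close to
    [u] keeps [act g \o act h] there. *)
Lemma cl_tau_idem (A : set G) : cl_tau (cl_tau A) `<=` cl_tau A.
Proof.
move=> eta /cl_tau_nbhs H; apply: cl_tau_EL => U W nU nW.
have [|g [b [/cl_tau_nbhs clb Ug Wgb]]] := H [set x : PS | nbhs (x \o u : PS) U] _ _ (nbhs_nbhs nW).
  by apply: nbhs_precomp; rewrite idemK.
have [h [a [Aa Uh Wh]]] := clb _ _ (post (nbhs_nbhs Ug)) (post (nbhs_nbhs Wgb)).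
exists (act g \o act h), a; split=> //; apply: EL_comp; exact: EL_act.
Qed.

Lemma cl_tau_mulr (A : set G) (eta b : G) :
  cl_tau A eta -> cl_tau [set a * b | a in A] (eta * b).
Proof.
move=> /cl_tau_nbhs H; apply/cl_tau_nbhs => U W nU /ptws_precomp nW.
have [g [a [Aa Ug Wga]]] := H _ _ nU nW.
by exists g, (a * b); split=> //; exists a.
Qed.

(** As [h] need not be continuous, it is approximated by [act g]. With [k] the inverse of [h], the
    map [act g \o act y \o k] is close to [u] and takes [h * a] to [act g \o act y \o a]. *)
Lemma cl_tau_mull (A : set G) (eta h : G) :
  cl_tau A eta -> cl_tau [set h * a | a in A] (h * eta).
Proof.
move=> /cl_tau_nbhs H; have [k [kh hk]] := ellis_inverse h.
apply: cl_tau_EL => U W nU nW.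
have hku : ellis_val h \o ellis_val k = u by rewrite -ellis_valM hk.
have khu : ellis_val k \o ellis_val h = u by rewrite -ellis_valM kh.
have nU' : nbhs (ellis_val h : PS) [set x : PS | nbhs (x \o ellis_val k : PS) U].
  by apply: nbhs_precomp; rewrite hku.
have [g [Ug Wg]] := EL_nbhs (filterI nU' (nbhs_precomp nW)) (ellis_EL (a := h)).
have nU2 : nbhs (u : PS) [set y : PS | nbhs (act g \o y \o ellis_val k : PS) U].
  apply: (@ptws_precomp _ _ u _ [set y : PS | nbhs (act g \o y : PS) U]).
  apply: (@post g (u \o ellis_val k) [set z : PS | nbhs z U]).
  by apply: nbhs_nbhs; rewrite ellis_u_val.
have [y [a [Aa Uy Wy]]] := H _ _ nU2 (post (nbhs_nbhs Wg)).
exists (act g \o act y \o ellis_val k), (h * a); split.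
- by apply: EL_comp (ellis_EL (a := k)); apply: EL_comp; exact: EL_act.
- by exists a.
- split=> //; have -> : act g \o act y \o ellis_val k \o ellis_val (h * a) =
      act g \o (act y \o ellis_val a) by rewrite -(ellis_u_val a) -khu.
  exact: Wy.
Qed.

(** After a left translation the target is 1. If [g a] is close to [eta], then [g a eta^-1] is close
    to [u], and its product with [eta a^-1] is [g u], close to [u] as well: the two neighborhoods
    exchange roles. *)
Lemma cl_tau_inv (A : set G) (inv : G -> G) (eta : G) :
  (forall a, inv a * a = 1 /\ a * inv a = 1) ->
  cl_tau A eta -> cl_tau [set inv a | a in A] (inv eta).
Proof.
move=> invP /cl_tau_nbhs H.
have comp (a b : G) : ellis_val a \o ellis_val b = ellis_val (a * b) by [].
suff : cl_tau [set eta * inv a | a in A] 1.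
  move=> /(cl_tau_mull (inv eta)); rewrite ellis_mul1; apply: cl_tauS.
  move=> _ [_ [a Aa <-] <-]; exists a => //.
  by rewrite ellis_mulA (invP eta).1 ellis_1mul.
apply: cl_tau_EL => U W nU nW.
have nU' : nbhs (ellis_val eta : PS) [set z : PS | nbhs (z \o ellis_val (inv eta) : PS) U].
  by apply: nbhs_precomp; rewrite comp (invP eta).2.
have nW' : nbhs (u : PS) [set z : PS | nbhs (z \o u : PS) W].
  by apply: nbhs_precomp; rewrite idemK.
have [g [a [Aa Wg Ug]]] := H _ _ nW' nU'.
exists (act g \o ellis_val (a * inv eta)), (eta * inv a); split.
- by apply: EL_comp (@ellis_EL _); exact: EL_act.
- by exists a.
- split=> //; have -> : act g \o ellis_val (a * inv eta) \o ellis_val (eta * inv a) =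
      act g \o ellis_val (a * inv eta * (eta * inv a)) by [].
  have -> : a * inv eta * (eta * inv a) = 1.
    rewrite ellis_mulA -(ellis_mulA a) (invP eta).1 ellis_mul1; exact: (invP a).2.
  exact: Wg.
Qed.

Lemma tau_closedP (A : set G) : closed A <-> cl_tau A `<=` A.
Proof. by rewrite -openC /open /= tau_openP setCK. Qed.

Lemma HuM_open (h : G) :
  HuM E h <-> forall U : set G, open U -> U 1 -> cl_tau U h.
Proof.
split=> [H U oU U1|H V]; first by apply: H; exact: open_nbhs_nbhs.
by rewrite nbhsE => -[U [oU U1] UV]; apply: cl_tauS UV _ _; exact: H.
Qed.

Lemma HuM_one : HuM E 1.
Proof. by apply/HuM_open => U _ U1; exact: cl_tau_ext. Qed.

(** For [v] in an open [U], the right translate of [U] by the inverse of [v] is an open neighborhood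
    of 1, so its closure contains [g]. Hence [g U] lies in the closure of [U]. *)
Lemma HuM_mul (g h : G) : HuM E g -> HuM E h -> HuM E (g * h).
Proof.
move=> /HuM_open Hg /HuM_open Hh; apply/HuM_open => U oU U1.
suff gU : [set g * a | a in U] `<=` cl_tau U.
  by apply: cl_tau_idem; apply: (cl_tauS gU); apply: cl_tau_mull; exact: Hh.
move=> _ [v Uv <-].
have oU' : open [set a | U (a * v)].
  rewrite -closedC; apply/tau_closedP => b /(cl_tau_mulr v) clb /= Ubv.
  move: oU; rewrite -closedC => /tau_closedP /(_ (b * v)); apply=> //.
  by apply: cl_tauS clb => _ [a nUav <-].
have := Hg _ oU'; rewrite /= ellis_1mul => /(_ Uv) /(cl_tau_mulr v).
by apply: cl_tauS => _ [a Uav <-].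
Qed.

Lemma HuM_inv (inv : G -> G) (h : G) :
  (forall a, inv a * a = 1 /\ a * inv a = 1) -> HuM E h -> HuM E (inv h).
Proof.
move=> invP /HuM_open Hh; apply/HuM_open => U oU U1.
have oU' : open [set a | U (inv a)].
  rewrite -closedC; apply/tau_closedP => b /(cl_tau_inv invP) clb /= Ub.
  move: oU; rewrite -closedC => /tau_closedP /(_ (inv b)); apply=> //.
  by apply: cl_tauS clb => _ [a nUa <-].
have inv1 : inv 1 = 1 by rewrite -[inv 1]ellis_mul1 (invP 1).1.
have := Hh _ oU'; rewrite /= inv1 => /(_ U1) /(cl_tau_inv invP).
by apply: cl_tauS => _ [a Ua <-].
Qed.

Lemma uMH_piP (a b : G) :
  \pi_(quo (HuM E)) a = \pi_(quo (HuM E)) b <-> exists2 h, HuM E h & a = b * h.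
Proof.
rewrite pi_quoE; split=> [ab|[h Hh ->]].
  have [h Hh <-] : coset (HuM E) b a.
    by rewrite -ab; exists 1; [exact: HuM_one|rewrite ellis_mul1].
  by exists h.
have [k [kh hk]] := ellis_inverse h.
have [inv invP] := choice ellis_inverse.
have Hk : HuM E k.
  suff -> : k = inv h by exact: HuM_inv.
  by rewrite -[k]ellis_mul1 -(invP h).2 ellis_mulA kh ellis_1mul.
apply/seteqP; split=> _ [n Hn <-].
  by exists (h * n); [exact: HuM_mul|rewrite ellis_mulA].
exists (k * n); first exact: HuM_mul.
by rewrite ellis_mulA -(ellis_mulA b) hk ellis_mul1.
Qed.

End EllisGroup.

(** * From the Ellis group to the Galois group *)

Section EllisToGalois.
Variables (L : language) (T : theory L) (N : monsterModel T) (C : smallModel N).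
Variables (kappa : Type) (hC : is_monster T kappa C) (E : minIdealIdem C).
Local Notation S := (typeSpace C).
Local Notation PS := {ptws S -> S}.
Local Notation u := (idem E).
Local Notation G := (ellisGroup E).
Local Notation tp1 := (tp_aut C 1).

Lemma fhat_comp (x y : S -> S) : EL x -> EL y -> fhat (x \o y) = fhat x * fhat y.
Proof.
move=> ELx ELy; rewrite /fhat /pi0 /=.
have [r [s [<- <- <-]]] := EL_rep (y tp1) ELx.
by rewrite !gal_tp pi_galM.
Qed.

Lemma fhat_idem : fhat u = 1.
Proof.
have ELu : EL u by exact: EL_idem.
 apply: (@gal_mulI _ _ _ (fhat u)).
by rewrite gal_mul1 -(fhat_comp ELu ELu) idemK.
Qed.

Definition fgal (a : G) : GalL N := fhat (ellis_val a).

Lemma fgalM (a b : G) : fgal (a * b) = fgal a * fgal b.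
Proof. exact: fhat_comp (@ellis_EL _ _ _ _ E a) (@ellis_EL _ _ _ _ E b). Qed.

Lemma fgal1 : fgal 1 = 1.
Proof. exact: fhat_idem. Qed.

Lemma fgal_retract (x : S -> S) : EL x ->
  exists2 a : G, ellis_val a = u \o (x \o u) & fgal a = fhat x.
Proof.
move=> ELx; have ELu : EL u by exact: EL_idem.
have [a aE] := ellis_of_ideal (ideal_comp ELx (idem_mem E)).
exists a => //; rewrite /fgal aE (fhat_comp ELu (EL_comp ELx ELu)) (fhat_comp ELx ELu).
by rewrite fhat_idem gal_1mul gal_mul1.
Qed.

Lemma fgal_surj (y : GalL N) : exists a, fgal a = y.
Proof.
have [s ->] := gal_surj y; have [x ELx xs] := EL_surj (tp_aut C s) hC.
by have [a _ aE] := fgal_retract ELx; exists a; rewrite aE /fhat /pi0 xs gal_tp.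
Qed.

(** An ultrafilter refining the net gives limits of lifts of the [g d], of representatives of the
    types [h d tp1], and of their products. The condition on [K] records that [tp_aut C s] is a
    limit of types [a(tp1)]. *)
Lemma cl_tau_limit (A : set G) (eta : G) : cl_tau A eta ->
  exists r s : aut N, [/\ tp_aut C r = u tp1, tp_aut C (r * s) = ellis_val eta tp1 &
    forall K : set S, closed K -> (forall a, A a -> K (ellis_val a tp1)) ->
      K (tp_aut C s)].
Proof.
move=> [_ [D [h [g [Ah gu gh]]]]].
have [F [UF DF]] := ultraFilterLemma (tails_filter D).
have [l lE] := choice (@aut_lift _ _ _ C).
have [t tE] := choice (fun d => typeSpace_rep (h d tp1)).
have [r [s [lr ls lrs]]] := ultra_limit C UF (l \o g) t.
have lim (y : D -> S) p : y @ tails D --> p -> y @ F --> p by move=> yp V /yp /DF.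
exists r, s; split.
- apply: type_limit_unique lr _; rewrite /=.
  under eq_fun do rewrite -[l _]mulg1 -(act_tp 1 (lE (g _))).
  exact/lim/((ptws_cvgP (fun d => act (g d)) u).1 gu).
- apply: type_limit_unique lrs _; rewrite /=.
  under eq_fun do rewrite -(act_tp (t _) (lE (g _))) -tE.
  exact/lim/((ptws_cvgP (fun d => act (g d) \o h d) (ellis_val eta)).1 gh).
- move=> K cK AK; apply: (closed_cvg _ cK _ _ ls).
  apply: filterS (@filterT _ F _) => d _ /=.
  by rewrite -tE; have [a /AK Ka <-] := Ah d.
Qed.

(* [tp(t) = tp(ts)] over [C] means that [c] and [s(c)] have the same type over
   the model [t^-1(C)]. *)
Definition same_over_model : set S :=
  [set p | exists s t, p = tp_aut C s /\ tp_aut C t = tp_aut C (t * s)].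

Lemma same_over_model_gal (p : S) : same_over_model p -> gal_of_type p = 1.
Proof.
move=> [s [t [-> e]]]; apply: (@gal_mulI _ _ _ (\pi_(GalL N) t)).
by rewrite gal_mul1 gal_tp -pi_galM -(gal_tp C) -e gal_tp.
Qed.

(** The limits of [s], [t] and [t * s] are realized by one pair, so the defining equality of types
    survives. *)
Lemma same_over_model_closed : closed same_over_model.
Proof.
move=> p /closure_ultra[F [UF FA Fp]].
have stP (z : S) : exists st : aut N * aut N, same_over_model z ->
    z = tp_aut C st.1 /\ tp_aut C st.2 = tp_aut C (st.2 * st.1).
  have [[s [t st]]|nz] := pselect (same_over_model z); first by exists (s, t).
  by exists (1, 1).
have [st stE] := choice stP.
have [t [s [lt ls lts]]] := ultra_limit C UF (fun z => (st z).2) (fun z => (st z).1).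
exists s, t; split.
  apply: (@type_limit_unique _ _ _ C _ F _ id) => //.
  apply: cvg_trans ls; apply: near_eq_cvg; apply: filterS FA => z /stE[zE _].
  exact: esym.
apply: type_limit_unique lt _.
apply: cvg_trans lts; apply: near_eq_cvg; apply: filterS FA => z /stE[_ zE].
exact: esym.
Qed.

Lemma fgal_HuM (h : G) : HuM E h -> fgal h = 1.
Proof.
move=> /HuM_open Hh.
pose I : set (formula L (idx C + C)) :=
  [set phi | same_over_model `<=` [set p | set_val p phi]].
have rs phi : I phi -> exists r s, [/\ tp_aut C r = u tp1,
    tp_aut C (r * s) = ellis_val h tp1 & set_val (tp_aut C s) phi].
  move=> Iphi; pose A := [set a : G | ~ set_val (ellis_val a tp1) phi].
  have oA : open (~` cl_tau A).
    by apply: closed_openC; apply/tau_closedP; exact: cl_tau_idem.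
  (* Otherwise [cl_tau_limit] gives [r] and [s] with [tp_aut C r = tp_aut C (r * s)] and
     [tp_aut C s] outside [phi], against the choice of [phi]. *)
  have A1 : (~` cl_tau A) 1.
    move=> /cl_tau_limit[r [s [rE rsE]]].
    move=> /(_ _ (@closed_formula _ _ _ C (fneg phi)) (fun a Aa => (type_neg _ _).2 Aa)).
    move=> /type_neg; apply; apply: (Iphi (tp_aut C s)).
    by exists s, r; rewrite rE rsE.
  have [r [s [rE rsE H]]] := cl_tau_limit (Hh _ oA A1).
  exists r, s; split=> //; apply: H (@closed_formula _ _ _ C phi) _ => a clA /=.
  by apply: contrapT => nphi; apply: clA; exact: cl_tau_ext.
(* The pair found above depends on [phi]. An ultrafilter containing every [B phi] yields a limit
   that satisfies all of [I]. *)
pose Q := [set x : aut N * aut N | tp_aut C x.1 = u tp1 /\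
  tp_aut C (x.1 * x.2) = ellis_val h tp1].
pose B phi := Q `&` [set x | set_val (tp_aut C x.2) phi].
have FP : ProperFilter (filter_from I B).
  apply: filter_from_proper; last first.
    by move=> phi /rs[r [s [rE rsE sphi]]]; exists (r, s).
  apply: filter_from_filter; first by exists (fneg fbot) => p _; exact: type_true.
  move=> phi psi Iphi Ipsi; exists (fand phi psi).
    by move=> p Pp; apply/type_and; split; [exact: Iphi|exact: Ipsi].
  by move=> x [Qx /type_and[xphi xpsi]].
have [F [UF FF]] := ultraFilterLemma FP.
have FQ : F Q.
  apply: FF; exists (fneg fbot); last by move=> x [].
  by move=> p _; exact: type_true.
have [q lq] := type_compact UF (fun x => tp_aut C x.2).
have Pq : same_over_model q.
  (* A neighborhood of [q] missing the closed set contains one given by a formula, whose negation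
     then belongs to [I]. *)
  apply: same_over_model_closed => V /nbhs_typeP[phi qphi phiV].
  apply: contrapT => /set0P/negP/negPn/eqP PV0.
  have In : I (fneg phi).
    move=> p Pp /=; apply/type_neg => /phiV Vp.
    by have : (same_over_model `&` V) p by []; rewrite PV0.
  have Fn : F (B (fneg phi)) by apply: FF; exists (fneg phi).
  have [x [[_ /= xn] /= xphi]] := filter_ex (filterI Fn ((type_cvgP _ _).1 lq phi qphi)).
  by move/type_neg: xn.
have := @gal_limit_mul _ _ _ C _ F UF fst snd (u tp1) q (ellis_val h tp1) _ lq _.
rewrite -[gal_of_type (ellis_val h _)]/(fgal h) -[gal_of_type (u _)]/(fhat u).
rewrite fhat_idem gal_1mul same_over_model_gal //; apply.
  by apply: cvg_near_cst; apply: filterS FQ => x [].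
by apply: cvg_near_cst; apply: filterS FQ => x [].
Qed.

Lemma fgal_closed (B : set (GalL N)) :
  closed [set p : S | B (gal_of_type p)] -> closed [set a | B (fgal a)].
Proof.
move=> cB; apply/tau_closedP => eta /cl_tau_limit[r [s [rE rsE H]]] /=.
have := H _ cB (fun _ => id); rewrite /= gal_tp => Bs.
rewrite /fgal /fhat /pi0 -rsE gal_tp pi_galM -(gal_tp C r) rE.
by rewrite -[gal_of_type _]/(fhat u) fhat_idem gal_1mul.
Qed.

(** A pointwise limit [x] of group elements satisfies [x \o u = x], so [u \o x] is again in the
    group, with the same class as [x]. *)
Lemma gal_closure (B : set (GalL N)) (q : S) :
  closed [set a | B (fgal a)] ->
  closure [set ellis_val a tp1 | a in [set a | B (fgal a)]] q -> B (gal_of_type q).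
Proof.
move=> /tau_closedP cB /closure_ultra[F [UF FA Fq]].
have aP (z : S) : exists a : G, [set ellis_val a tp1 | a in [set a | B (fgal a)]] z ->
    B (fgal a) /\ ellis_val a tp1 = z.
  have [[a Ba <-]|nz] := pselect ([set ellis_val a tp1 | a in [set a | B (fgal a)]] z).
    by exists a.
  by exists 1.
have [a aE] := choice aP.
have [x xP] := choice (fun p => type_compact UF (fun z => ellis_val (a z) p)).
have ELx : EL x.
  apply: EL_limit xP; apply: filterS (@filterT _ F _) => z _; exact: ellis_EL.
have xu : x \o u = x.
  apply/funext => p; apply: type_limit_unique (xP (u p)) _.
  under eq_fun do rewrite -[ellis_val _ (u p)]/((ellis_val _ \o u) p) ellis_val_u.
  exact: xP.
have [b bE] : exists b : G, ellis_val b = u \o x.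
  by apply: ellis_of_ideal; rewrite -xu; apply: ideal_comp => //; exact: idem_mem.
have : B (fgal b).
  apply: cB; apply/cl_tau_nbhs => U W nU /nbhs_nbhs; rewrite bE => /ptws_precomp nW.
  (* First [g] is chosen with [act g \o x] close to [u \o x], then [a z] close to [x], by continuity
     of [act g]. *)
  have [g [Ug Wg]] := EL_nbhs (filterI nU nW) (@EL_idem _ _ _ _ E).
  have ax : (fun z => ellis_val (a z) : PS) @ F --> (x : PS) by exact/ptws_cvgP.
  have Fa : F [set z | W (act g \o ellis_val (a z))].
    exact: ax (ptws_postcomp (@act_continuous _ _ _ _ g) Wg).
  have [z [Wz /aE[Bz _]]] := filter_ex (filterI Fa FA).
  by exists g, (a z).
rewrite /fgal bE (fhat_comp (@EL_idem _ _ _ _ E) ELx).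
rewrite fhat_idem gal_1mul /fhat /pi0.
suff -> : q = x tp1 by [].
apply: (@type_limit_unique _ _ _ C _ F _ id) => //.
apply: cvg_trans (xP tp1); apply: near_eq_cvg; apply: filterS FA => z /aE[_ zE].
by [].
Qed.

Lemma gal_closed_of_fgal (B : set (GalL N)) :
  closed [set a | B (fgal a)] -> closed [set p : S | B (gal_of_type p)].
Proof.
move=> cB p /closure_ultra[F [UF FB Fp]] /=.
have ELu : EL u by exact: EL_idem.
have xex (z : S) : exists x : S -> S, EL x /\ x tp1 = z.
  by have [x ELx xz] := EL_surj z hC; exists x.
have [x xP] := choice xex.
(* The products [al z * si z] represent [x z (u tp1)], and [be z * ti z] below represent
   [u (x z (u tp1))]. The classes of the limits agree with that of [p] because [u] has trivial
   class. *)
have [al alP] := choice (fun z => EL_rep (u tp1) (xP z).1).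
have [si alsiP] := choice alP.
have [be beP] := choice (fun z => EL_rep (x z (u tp1)) ELu).
have [ti betiP] := choice beP.
have [q1 lq1] := type_compact UF (fun z => tp_aut C (al z * si z)).
have [q2 lq2] := type_compact UF (fun z => tp_aut C (be z * ti z)).
have gu : gal_of_type (u tp1) = 1 by exact: fhat_idem.
have q1E : gal_of_type q1 = gal_of_type p.
  rewrite (@gal_limit_mul _ _ _ C _ F UF al si p (u tp1) q1) ?gu ?gal_mul1 //.
  - suff -> : (fun z => tp_aut C (al z)) = id by [].
    by apply/funext => z; have [-> _ _] := alsiP z; exact: (xP z).2.
  - suff -> : (fun z => tp_aut C (si z)) = fun=> u tp1 by exact: cvg_cst.
    by apply/funext => z; have [] := alsiP z.
have q2E : gal_of_type q2 = gal_of_type p.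
  rewrite (@gal_limit_mul _ _ _ C _ F UF be ti (u tp1) q1 q2) ?gu ?gal_1mul //.
  - suff -> : (fun z => tp_aut C (be z)) = fun=> u tp1 by exact: cvg_cst.
    by apply/funext => z; have [] := betiP z.
  - suff -> : (fun z => tp_aut C (ti z)) = fun z => tp_aut C (al z * si z) by [].
    by apply/funext => z; have [_ -> _] := betiP z; have [_ _ ->] := alsiP z.
rewrite -q2E; apply: gal_closure => //.
apply: (@closed_cvg _ _ F _ _ _ (@closed_closure _ _) _ _ lq2).
apply: filterS FB => z /= Bz; apply: subset_closure.
have [ELx xz] := xP z; have [a aE fa] := fgal_retract ELx.
exists a; first by rewrite /= fa /fhat /pi0 xz.
by have [_ _ ->] := betiP z; rewrite aE.
Qed.

(** * The induced maps on the quotients *)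

Lemma fbar_pi (a : G) : fbar E (\pi_(uMH E) a) = fgal a.
Proof.
have [h Hh aE] : exists2 h, HuM E h & repr (\pi_(uMH E) a) = a * h.
  by apply/uMH_piP; exact: reprK.
by rewrite /fbar -[LHS]/(fgal _) aE fgalM (fgal_HuM Hh) gal_mul1.
Qed.

Lemma uMH_rep (x : uMH E) : exists a, x = \pi_(uMH E) a.
Proof. by exists (repr x); rewrite reprK. Qed.

Lemma fbar_surj (y : GalL N) : exists x, fbar E x = y.
Proof. by have [a <-] := fgal_surj y; exists (\pi_(uMH E) a); rewrite fbar_pi. Qed.

Lemma fbarM : {morph fbar E : x y / x * y}.
Proof.
move=> x y; rewrite -[x * y]/(\pi_(uMH E) (repr x * repr y)) fbar_pi fgalM.
by rewrite -!fbar_pi !reprK.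
Qed.

Lemma fbar1 : fbar E 1 = 1.
Proof. by rewrite -[1]/(\pi_(uMH E) 1) fbar_pi fgal1. Qed.

(** Left division is what the comparison of cosets of [ker_fbar] uses. *)
Lemma uMH_divide (x y : uMH E) : exists z, y * z = x.
Proof.
have [a ->] := uMH_rep x; have [b [bb bb']] := ellis_inverse (repr y).
exists (\pi_(uMH E) (b * a)); rewrite -[LHS]/(\pi_(uMH E) (repr y * repr _)).
have [h Hh ->] : exists2 h, HuM E h & repr (\pi_(uMH E) (b * a)) = b * a * h.
  by apply/uMH_piP; exact: reprK.
apply/uMH_piP; exists h => //.
by rewrite ellis_mulA (ellis_mulA _ b) bb' ellis_1mul.
Qed.

Lemma uMHker_piP (x y : uMH E) :
  \pi_(quo (ker_fbar (E := E))) x = \pi_(quo (ker_fbar (E := E))) y <->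
  fbar E x = fbar E y.
Proof.
rewrite pi_quoE; split=> [xy|].
  have : coset (ker_fbar (E := E)) x (x * 1) by exists 1 => //; exact: fbar1.
  rewrite xy => -[n /= n1 /(congr1 (fbar E))].
  by rewrite !fbarM fbar1 n1 !gal_mul1.
have sub (x' y' : uMH E) : fbar E x' = fbar E y' ->
    coset (ker_fbar (E := E)) x' `<=` coset (ker_fbar (E := E)) y'.
  move=> xy _ [n n1 <-]; have [m mE] := uMH_divide (x' * n) y'; exists m => //.
  apply: (@gal_mulI _ _ _ (fbar E y')).
  by rewrite -fbarM mE fbarM n1 xy.
by move=> xy; apply/seteqP; split; apply: sub.
Qed.

Lemma fbar_ind_pi (x : uMH E) : fbar_ind E (\pi_(uMHker E) x) = fbar E x.
Proof. by rewrite /fbar_ind; apply/uMHker_piP; exact: reprK. Qed.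

Lemma fbar_indM : {morph fbar_ind E : x y / x * y}.
Proof.
move=> x y; rewrite -[x * y]/(\pi_(uMHker E) (repr x * repr y)) fbar_ind_pi fbarM.
by rewrite -!fbar_ind_pi !reprK.
Qed.

Lemma fbar_ind_inj : injective (fbar_ind E).
Proof.
move=> x y; rewrite -[x]reprK -[y]reprK !fbar_ind_pi => xy.
exact/uMHker_piP.
Qed.

Lemma fbar_closed (M : smallModel N) (B : set (galTop M)) :
  closed B <-> closed (fbar E @^-1` B : set (uMH E)).
Proof.
have -> : closed (fbar E @^-1` B : set (uMH E)) <-> closed [set a : G | B (fgal a)].
  rewrite -!openC -[open (~` (fbar E @^-1` B))]/(open (\pi_(uMH E) @^-1` _)).
  rewrite (_ : _ @^-1` _ = ~` [set a : G | B (fgal a)]) //.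
  by apply/seteqP; split=> a /=; rewrite fbar_pi.
rewrite gal_closedP; split=> [cB|/gal_closed_of_fgal cB].
  exact: fgal_closed (@gal_closed_independent _ _ _ M C B cB).
exact: (@gal_closed_independent _ _ _ C M B cB).
Qed.

End EllisToGalois.

Theorem corollary3p12 (L : language) (T : theory L) (hT : complete_theory T)
    (C' : monsterModel T) (C : smallModel C')
    (kappa : Type) (hC : is_monster T kappa C)
    (E : minIdealIdem C) (M : smallModel C') :
  [/\ forall y : GalL C', exists x : uMH E, fbar E x = y,
      {morph fbar E : x y / x * y >-> x * y} &
      forall B : set (galTop M),
        closed B <-> closed (fbar E @^-1` B : set (uMH E))] /\
  [/\ bijective (fbar_ind E),
      {morph fbar_ind E : x y / x * y >-> x * y} &
      homeomorphism (fbar_ind E : uMHker E -> galTop M)].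
Proof.
have fbarS := fbar_surj hC E.
have kex (y : GalL C') : exists z : uMHker E, fbar_ind E z = y.
  have [x <-] := fbarS y.
  by exists (\pi_(uMHker E) x); rewrite fbar_ind_pi.
have [k kP] := choice kex.
have fK : cancel (fbar_ind E) k by move=> x; apply: fbar_ind_inj; rewrite kP.
split; split=> //; [exact: fbarM|exact: (fbar_closed hC)|by exists k|exact: fbar_indM|].
(* Both continuity claims are pulled back to [uMH E], where [fbar_closed] applies. *)
exists k; split=> //; apply/continuous_closedP => A cA.
  rewrite -openC -[open _]/(open (\pi_(uMHker E) @^-1` _)).
  rewrite (_ : _ @^-1` _ = ~` (fbar E @^-1` A)); last first.
    by apply/seteqP; split=> x /=; rewrite fbar_ind_pi.
  by rewrite openC; apply/(fbar_closed hC).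
apply/(fbar_closed hC E); rewrite -openC.
move: cA; rewrite -openC -[open (~` A)]/(open (\pi_(uMHker E) @^-1` _)).
suff -> : \pi_(uMHker E) @^-1` (~` A) = ~` (fbar E @^-1` (k @^-1` A)) by [].
by apply/seteqP; split=> x /=; rewrite -fbar_ind_pi fK.
Qed.
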